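(* Let $\Bbbk$ be an infinite field and let $\Delta$ be a $(d-1)$-dimensional simplicial complex. Then $$h_{d-1}^{\mathfrak{s}}(\Delta) = h_{d-1}(\Delta) + (-1)^{d-1}\sum_{F\in \Delta}\binom{d-|F|}{d-1}\widetilde{\chi}_{d-2-|F|}(\mathrm{lk}_\Delta F).$$
   Context: A simplicial complex $\Delta$ on a finite vertex set $V$ is a collection of subsets (faces) of $V$ closed under inclusion; $\dim F=|F|-1$ and $\dim\Delta=\max_{F\in\Delta}\dim F$. The sum runs over all faces, including $F=\emptyset$. The link is $\mathrm{lk}_\Delta F=\{G\in\Delta: F\cup G\in\Delta,\ F\cap G=\emptyset\}$, so $\mathrm{lk}_\Delta\emptyset=\Delta$. With $f_i(\Delta)$ the number of $i$-dimensional faces, $h_i(\Delta)=\sum_{j=0}^i(-1)^{i-j}\binom{d-j}{i-j}f_{j-1}(\Delta)$ for $0\le i\le d$. $\widetilde\beta_j(\Gamma)=\dim_\Bbbk\widetilde H^j(\Gamma;\Bbbk)$ is the reduced Betti number over $\Bbbk$ (the empty face counts in dimension $-1$, so $\widetilde\beta_{-1}(\{\emptyset\})=1$), and the truncated reduced Euler characteristic is $\widetilde\chi_i(\Gamma)=\sum_{j=-1}^{i}(-1)^j\widetilde\beta_j(\Gamma)$ (equal to $0$ for $i<-1$). Let $A=\Bbbk[x_v:v\in V]$ with $\deg x_v=1$, and $\Bbbk[\Delta]=A/I_\Delta$ with $I_\Delta=(\prod_{v\in F}x_v: F\subset V,\ F\notin\Delta)$; it has Krull dimension $d$. A linear system of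 parameters (l.s.o.p.) for $\Bbbk[\Delta]$ is a sequence $\Theta=(\theta_1,\dots,\theta_d)$ of linear forms in $A$ such that $\Bbbk[\Delta]/(\Theta)\Bbbk[\Delta]$ is finite-dimensional over $\Bbbk$. For $M=\Bbbk[\Delta]$ the sigma submodule is $$\Sigma(\Theta;M)=\Theta M+\sum_{i=1}^d\big((\theta_1,\dots,\theta_{i-1},\theta_{i+1},\dots,\theta_d)M:_M\theta_i\big),$$ where $N:_M\theta_i=\{m\in M:\theta_i m\in N\}$. The reduced algebraic $h$-vector has entries $h_i^{\mathfrak s}(\Delta)=\dim_\Bbbk\left(\Bbbk[\Delta]/\Sigma(\Theta;\Bbbk[\Delta])\right)_i$ for a generic l.s.o.p. $\Theta$; ''generic'' means for all $\Theta$ in some nonempty Zariski-open subset of the space of $d$-tuples of linear forms, on which this dimension is constant. *)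

(* Defs.v *)
From HB Require Import structures.
From mathcomp Require Import all_boot all_order all_algebra.
From mathcomp Require Import boolp.
From mathcomp Require Import mpoly.

Set Implicit Arguments.
Unset Strict Implicit.
Unset Printing Implicit Defensive.

Import GRing.Theory.
Local Open Scope ring_scope.

(* The empty face is required: this excludes only the void complex, which has
   no dimension.  Elements of V need not be vertices of the complex. *)
Record complex (V : finType) := Complex {
  faces :> {set {set V}};
  face0 : set0 \in faces;
  face_sub : forall F G : {set V}, G \subset F -> F \in faces -> G \in faces
}.

Section Combinatorics.
Variable V : finType.
Implicit Types (D : {set {set V}}) (F G : {set V}).

(* dim D + 1 *)
Definition dimS D : nat := \max_(F in D) #|F|.

Definition link D F : {set {set V}} :=
  [set G in D | (F :|: G \in D) && (F :&: G == set0)].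

(* Faces are indexed by cardinality, so that kfaces D j is the set of the
   (j - 1)-dimensional faces and #|kfaces D j| is f_{j-1}. *)
Definition kfaces D (j : nat) : {set {set V}} := [set F in D | #|F| == j].

Definition hnum D (d i : nat) : int :=
  \sum_(j < i.+1) (-1) ^+ (i - j) * ('C(d - j, i - j) * #|kfaces D j|)%N%:Z.

End Combinatorics.

Section Cohomology.
Variables (K : fieldType) (V : finType).
Implicit Types (D : {set {set V}}) (F G : {set V}).

(* [G : F] for the orientation given by the enumeration order of V: it is
   (-1)^#{w in F | w < v} if F = G \ v with v in G, and 0 otherwise. *)
Definition incidence F G : K :=
  \sum_(v in G | F == G :\ v)
     (-1) ^+ #|[set w in F | (enum_rank w < enum_rank v)%N]|.

(* Coboundary C^{m-1} -> C^m of the augmented cochain complex, where C^{m-1} is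
   the space of row vectors indexed by the faces of cardinality m. *)
Definition coboundary D m : 'M[K]_(#|kfaces D m|, #|kfaces D m.+1|) :=
  \matrix_(i, j) incidence (enum_val i) (enum_val j).

(* bettiS D m is the reduced Betti number of index m - 1:
   dim Z^{m-1} - dim B^{m-1}, with B^{-1} = 0. *)
Definition bettiS D (m : nat) : nat :=
  (\rank (kermx (coboundary D m))
     - (if m is m'.+1 then \rank (coboundary D m') else 0))%N.

(* The sum of (-1)^j betti_j over -1 <= j <= i, with j = m - 1. *)
Definition tchi D (i : int) : int :=
  match i + 2%:Z with
  | Posz k => \sum_(m < k) (-1) ^+ m.+1 * (bettiS D m)%:Z
  | Negz _ => 0
  end.

End Cohomology.

Section Ideals.
Variable R : comNzRingType.

Definition in_ideal (I : finType) (P : pred I) (g : I -> R) (x : R) : Prop :=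
  exists a : I -> R, x = \sum_(i | P i) a i * g i.

(* Sigma(theta; M) for M = R, as a predicate on R. *)
Definition in_sigma d (theta : 'I_d -> R) (x : R) : Prop :=
  exists (u : R) (v : 'I_d -> R),
    [/\ in_ideal predT theta u,
        forall i, in_ideal (predC1 i) theta (theta i * v i)
      & x = u + \sum_(i < d) v i].

End Ideals.

Section FaceRing.
Variables (K : fieldType) (V : finType).

(* x_v is the variable of index enum_rank v. *)
Notation A := {mpoly K[#|V|]}.

Definition xmon (F : {set V}) : A := \prod_(v in F) 'X_(enum_rank v).

Definition SRideal (Delta : complex V) (p : A) : bool :=
  `[< in_ideal (fun F : {set V} => F \notin Delta) xmon p >].

Lemma SRideal_closed Delta : idealr_closed (SRideal Delta).
Proof.
split=> [||a p q].
- by apply/asboolP; exists (fun=> 0); rewrite big1 // => F _; rewrite mul0r.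
- apply/negP=> /asboolP[a /(congr1 (meval (fun=> 0)))].
  rewrite meval1 raddf_sum /= big1 => [/eqP|F nF]; first by rewrite oner_eq0.
  have [v vF] : exists v, v \in F.
    by apply/set0Pn; apply: contraNneq nF => ->; apply: face0.
  by rewrite mevalM /xmon (bigD1 v) //= mevalM mevalXU mul0r mulr0.
move=> /asboolP[b ->] /asboolP[c ->]; apply/asboolP.
exists (fun F => a * b F + c F); rewrite mulr_sumr -big_split /=.
by apply: eq_bigr => F _; rewrite mulrDl mulrA.
Qed.

Definition SRidealr (Delta : complex V) : idealr A :=
  HB.pack (SRideal Delta)
    (GRing.isZmodClosed.Build _ (SRideal Delta)
       (idealr_closedB (SRideal_closed Delta)))
    (isProperIdeal.Build _ (SRideal Delta)
       (idealr_closed_nontrivial (SRideal_closed Delta))).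

Definition SRring (Delta : complex V) : comNzRingType :=
  {ideal_quot (SRidealr Delta)}.

Definition SRpi (Delta : complex V) : A -> SRring Delta :=
  \pi_({ideal_quot (SRidealr Delta)})%qT.

(* A d-tuple of linear forms is given by its matrix of coefficients. *)
Definition linform d (C : 'M[K]_(d, #|V|)) (i : 'I_d) : A :=
  \sum_(j < #|V|) C i j *: 'X_j.

Definition SRforms (Delta : complex V) d (C : 'M[K]_(d, #|V|)) (i : 'I_d) :
  SRring Delta := SRpi Delta (linform C i).

(* The tuple length d is meant to be dimS Delta. *)
Definition lsop (Delta : complex V) d (C : 'M[K]_(d, #|V|)) : Prop :=
  exists (n : nat) (b : 'I_n -> A), forall p : A, exists c : 'I_n -> K,
    in_ideal predT (SRforms Delta C) (SRpi Delta (p - \sum_(k < n) c k *: b k)).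

(* The degree i part of k[Delta]/Sigma(Theta; k[Delta]) has dimension n: it has
   a basis formed by the classes of n homogeneous polynomials of degree i. *)
Definition sigma_quot_dim (Delta : complex V) d (C : 'M[K]_(d, #|V|))
    (i n : nat) : Prop :=
  exists2 b : 'I_n -> A, (forall k, b k \is i.-homog) &
    forall p : A, p \is i.-homog -> exists! c : 'rV[K]_n,
      in_sigma (SRforms Delta C) (SRpi Delta (p - \sum_(k < n) c 0 k *: b k)).

Definition zariski_open m n (U : 'M[K]_(m, n) -> Prop) : Prop :=
  exists S : {mpoly K[m * n]} -> Prop,
    forall C, U C <-> exists2 P, S P & P.@[mxvec C 0] != 0.

(* n is h_i^s(Delta).  Over an infinite field nonempty Zariski-open sets of
   matrices meet, so that there is at most one such n. *)
Definition reduced_h (Delta : complex V) (i n : nat) : Prop :=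
  exists U : 'M[K]_(dimS Delta, #|V|) -> Prop,
    [/\ zariski_open U, exists C, U C &
        forall C, U C -> lsop Delta C /\ sigma_quot_dim Delta C i n].

End FaceRing.

(* Main.v *)
From HB Require Import structures.
Require Import Defs.
From mathcomp Require Import all_boot all_order all_algebra.
From mathcomp Require Import boolp mpoly ring zify.

Set Implicit Arguments.
Unset Strict Implicit.
Unset Printing Implicit Defensive.

Import GRing.Theory.
Local Open Scope ring_scope.

(** Write d = n + 1 for dim + 1, M for the face ring and p_v for the vector in
    K^d of the coefficients of theta_1, ..., theta_d at the vertex v.  Faces
      with d
    elements are called facets and faces with d - 1 elements ridges.  The open
    set is the set of matrices in which any d columns are independent.

    Modulo Theta every homogeneous element of M is a combination of squarefree
    monomials: if x_v^2 divides a monomial supported on a face H, then some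
    combination of the theta_i equals x_v plus variables outside H, and
    replacing one factor x_v enlarges the support ([squarefree_reduction]).
    This makes Theta a system of parameters, and it makes the degree d - 1 part
    of M / Sigma the quotient of the space K^ridges of combinations of ridge
    monomials by some subspace P.

    To find P, let N_G be the covector of maximal minors of the p_v, v in G, for
    a ridge G.  It vanishes at these p_v, so the linear form N_G(Theta) times
    x_G is a combination of facet monomials.  Take a vector y_G in K^d for every
    ridge such that, for every facet F, the sum over u in F of
    N_{F - u}(p_u) y_{F - u} is zero.  Then for each i the elements
    a_j = sum_G y_{G,i} N_{G,j} x_G satisfy sum_j theta_j a_j = 0, hence a_i is
    in Sigma; adding these over i puts sum_G N_G(y_G) x_G in Sigma
    ([sigma_of_cocycle]).  These vectors exhaust P ([sigma_spaceP]).  Indeed a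
    functional t which kills them yields, by duality, a covector s_F for every
    facet.  Above a general point q of K^d the variety of M has one point in
    the coordinate plane of each facet, and a sum over this fibre, weighted by
    the s_F, gives a functional on M which theta_j multiplies by q_j, which
    vanishes in degree less than d - 1 and which in degree d - 1 does not depend
    on q and equals t on ridge monomials ([trace_ridge], [trace_low],
    [trace_generic]).  Applied to a relation sum_j theta_j a_j = 0 it gives
    sum_j q_j t(a_j) = 0 for all general q, so that t kills every a_j.

    It remains to compute dim P.  The number N_{F - u}(p_u) is the incidence
    number of F - u in F times det(p_F), so the condition on y says that each of
    its d coordinates is a simplicial cocycle ([dim_cocycles]).  The y with all
    N_G(y_G) = 0 are those with y_G in the span of the p_v, v in G, and their
    coefficients along p_v form a cocycle of the link of v ([dim_tangent]).
    With z for the dimension of the space of cocycles, the dimension sought is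

      f_{d-2} - d z^{d-2}(Delta) + sum_v z^{d-3}(lk v),

    and this is the right-hand side of the formula: its binomial coefficients
    leave only the empty face and the vertices, and a truncated Euler
    characteristic is its last z up to sign plus an alternating sum of face
    numbers ([sum_bettiS], [h_number_formula]). *)

(** * Linear algebra *)

Section LinearAlgebra.
Variable K : fieldType.

Lemma dim_lker_mulmxr m n (A : 'M[K]_(m, n)) :
  \dim (lker (linfun (mulmxr A : 'rV_m -> 'rV_n))) = \rank (kermx A).
Proof.
set U := lker _.
pose X := [tuple row i (row_base (kermx A)) | i < \rank (kermx A)].
suff: basis_of U X by move/vector.size_basis.
have comb (c : 'I_(\rank (kermx A)) -> K) :
    \sum_i c i *: X`_i = (\row_i c i) *m row_base (kermx A).
  rewrite mulmx_sum_row; apply: eq_bigr => i _.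
  by rewrite -tnth_nth tnth_mktuple mxE.
apply/andP; split; last first.
  apply/freeP => c; rewrite comb => /eqP c0 i.
  have /eqP/rowP/(_ i) : (\row_i c i) == 0.
    by rewrite -(mulmx_free_eq0 _ (row_base_free (kermx A))).
  by rewrite !mxE.
apply/eqP/vspaceP => y; apply/idP/idP => [/coord_span ->|].
  rewrite comb memv_ker lfunE /= -mulmxA.
  have -> : row_base (kermx A) *m A = 0.
    by apply/sub_kermxP; rewrite eq_row_base.
  by rewrite mulmx0.
rewrite memv_ker lfunE /= => /eqP /sub_kermxP.
rewrite -(eq_row_base (kermx A)) => /submxP[c ->].
have -> : c *m row_base (kermx A) = \sum_i c 0 i *: X`_i.
  by rewrite comb; congr (_ *m _); apply/rowP => i; rewrite mxE.
apply: memv_suml => i _; apply/memvZ/memv_span/mem_nth.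
by rewrite size_tuple.
Qed.

(** The [iota i] embed the [T i] as independent summands of [W], with the [pr
    i] as projections. This computes the dimension of any subspace that is cut
    out componentwise, without fixing bases. *)
Lemma dim_retract_sum (I : finType) (W : vectType K) (T : I -> vectType K)
    (iota : forall i, 'Hom(T i, W)) (pr : forall i, 'Hom(W, T i))
    (U : forall i, {vspace T i}) (X : {vspace W}) :
    (forall i x, pr i (iota i x) = x) ->
    (forall i j x, i != j -> pr j (iota i x) = 0) ->
    (forall i x, x \in U i -> iota i x \in X) ->
    (forall i w, w \in X -> pr i w \in U i) ->
    (forall w, w \in X -> w = \sum_i iota i (pr i w)) ->
  \dim X = (\sum_i \dim (U i))%N.
Proof.
move=> prK pr0 iotaX prU sumX.
have -> : X = (\sum_i iota i @: U i)%VS.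
  apply/eqP; rewrite eqEsubv; apply/andP; split; apply/subvP => w.
    move=> wX; rewrite (sumX w wX); apply: memv_sumr => i _.
    by apply/memv_img/prU.
  case/memv_sumP => u uU ->; apply: memv_suml => i _.
  by have /memv_imgP[x xU ->] := uU i isT; apply: iotaX.
have /directvP -> /= : directv (\sum_i iota i @: U i).
  apply/directv_sum_independent => u uU u0 i _.
  have {}uU j : u j = iota j (pr j (u j)).
    by have /memv_imgP[x _ ->] := uU j isT; rewrite prK.
  rewrite uU; suff -> : pr i (u i) = 0 by rewrite linear0.
  rewrite -[RHS](linear0 (pr i)) -u0 linear_sum (bigD1 i) //= big1 ?addr0 //.
  by move=> j ji; rewrite uU pr0.
apply: eq_bigr => i _; apply: limg_dim_eq; apply/eqP.
rewrite -subv0; apply/subvP => x; rewrite memv_cap memv_ker memv0.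
by case/andP=> _ /eqP x0; rewrite -(prK i x) x0 linear0.
Qed.

(** A nonzero coordinate of the component of [x] in a complement of [P] would
    be a functional that kills [P] but not [x]. *)
Lemma separating_functional R (P : {vspace 'rV[K]_R}) (x : 'rV_R) :
    (forall t : 'cV_R, (forall y, y \in P -> y *m t = 0) -> x *m t = 0) ->
  x \in P.
Proof.
move=> xP; pose f := (\1 - projv P)%VF.
have fP y : y \in P -> f y = 0.
  by move=> yP; rewrite add_lfunE opp_lfunE id_lfunE projv_id ?subrr.
suff: f x = 0.
  rewrite add_lfunE opp_lfunE id_lfunE => /eqP.
  by rewrite subr_eq0 => /eqP ->; apply: memv_proj.
apply/rowP => j; rewrite -(mul_rV_lin1 f) mxE.
transitivity ((x *m col j (lin1_mx f)) 0 0); last first.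
  rewrite xP ?mxE // => y yP; apply/matrixP => a b; rewrite !ord1 !mxE.
  have /rowP/(_ j) := fP y yP; rewrite -(mul_rV_lin1 f) !mxE => e0.
  by rewrite -[RHS]e0; apply: eq_bigr => k _; rewrite !mxE.
by rewrite mxE; apply: eq_bigr => k _; rewrite !mxE.
Qed.

Lemma kermx_annihilator m n (D : 'M[K]_(m, n)) (w : 'cV_m) :
  kermx D *m w = 0 -> exists s, w = D *m s.
Proof.
move=> kw; suff: (w^T <= D^T)%MS.
  by case/submxP=> s ws; exists s^T; rewrite -[w]trmxK ws trmx_mul trmxK.
have kD : ((cokermx D^T)^T <= kermx D)%MS.
  by apply/sub_kermxP; rewrite -[D in _ *m D]trmxK -trmx_mul mulmx_coker trmx0.
rewrite submxE; apply/eqP/trmx_inj; rewrite trmx_mul trmxK trmx0.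
by case/submxP: kD => E ->; rewrite -mulmxA kw mulmx0.
Qed.

Definition dotv m (a q : 'I_m -> K) : K := \sum_i a i * q i.

Lemma dotvZ m (b x : 'I_m -> K) (k : K) :
  dotv b (fun i => k * x i) = k * dotv b x.
Proof. by rewrite /dotv mulr_sumr; apply: eq_bigr => i _; rewrite mulrCA. Qed.

Hypothesis K_infinite : forall s : seq K, exists x : K, x \notin s.

(** On the moment curve (1, x, x^2, ...) each linear form becomes a nonzero
    polynomial in x, and over an infinite field some x is a root of none. *)
Lemma avoid_hyperplanes m (I : finType) (a : I -> 'I_m -> K) :
    (forall k, exists i, a k i != 0) ->
  exists q : 'I_m -> K, forall k, dotv (a k) q != 0.
Proof.
move=> nz; pose p k := \poly_(i < m) oapp (a k) 0 (insub i : option 'I_m).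
have p0 : \prod_k p k != 0.
  apply/prodf_neq0 => k _; have [i ai] := nz k; apply: contra_neq ai => pk0.
  have := congr1 (fun r : {poly K} => r`_i) pk0.
  by rewrite /= coef_poly ltn_ord coef0 valK.
have [x xP] : exists x, ~~ root (\prod_k p k) x.
  have [s hs] : exists s : seq K, forall x, root (\prod_k p k) x -> x \in s.
    have [n] := ubnP (size (\prod_k p k)).
    move: p0; elim: n (\prod_k p k) => // n IH r r0 szr.
    have [[x rx]|nr] := pselect (exists x, root r x); last first.
      by exists [::] => x rx; case: nr; exists x.
    have [r' rE] := factor_theorem r x rx.
    have r'0 : r' != 0 by apply: contra_neq r0 => r'0; rewrite rE r'0 mul0r.
    have [|s hs] := IH r' r'0.
      by move: szr; rewrite rE size_Mmonic ?monicXsubC // size_XsubC addn2.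
    exists (x :: s) => y; rewrite rE rootM root_XsubC in_cons.
    by case/orP=> [/hs ys|yx]; apply/orP; [right | left].
  by have [x xs] := K_infinite s; exists x; apply: contra xs => /hs.
exists (fun i => x ^+ i) => k; move: xP.
rewrite (bigD1 k) //= rootM negb_or => /andP[+ _].
rewrite /root horner_poly; congr (_ != 0); apply: eq_bigr => i _.
by rewrite valK.
Qed.

(** Otherwise [L] could be added to the hyperplanes to be avoided. *)
Lemma dotv_generic_eq0 m (I : finType) (a : I -> 'I_m -> K) (L : 'I_m -> K) :
    (forall k, exists i, a k i != 0) ->
    (forall q, (forall k, dotv (a k) q != 0) -> dotv L q = 0) ->
  forall i, L i = 0.
Proof.
move=> nz L0 i; apply/eqP/negP => Li.
have [|q hq] := @avoid_hyperplanes m (option I)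
  (fun o => if o is Some k then a k else L).
  by case=> [k|]; [apply: nz | exists i; apply/negP].
by have /eqP[] := hq None; apply: L0 => k; apply: (hq (Some k)).
Qed.

End LinearAlgebra.

(** * Minors of a matrix in general position *)

Section Sets.
Variable V : finType.
Implicit Types (F G H X : {set V}) (u v w : V).

Lemma enum_rank_index v : enum_rank v = index v (enum V) :> nat.
Proof. by rewrite -{2}(nth_enum_rank v v) index_uniq ?enum_uniq // -cardE. Qed.

Lemma enum_filter X : enum X = [seq w <- enum V | w \in X].
Proof. by rewrite enumT. Qed.

(** The position of [u] in the enumeration of [F] is the exponent of the
    incidence sign, which is what links column expansions of determinants to
    coboundaries. *)
Lemma enum_setD1 F u : u \in F ->
  exists s1 s2, [/\ enum F = s1 ++ u :: s2, enum (F :\ u) = s1 ++ s2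
    & size s1 = #|[set w in F :\ u | (enum_rank w < enum_rank u)%N]|].
Proof.
move=> uF; have [s1 [s2 eV]] : exists s1 s2, enum V = s1 ++ u :: s2.
  have uV : u \in enum V by rewrite mem_enum.
  by case/splitPr: uV => s1 s2; exists s1, s2.
have := enum_uniq V; rewrite eV uniq_catC /= mem_cat negb_or =>
  /andP[/andP[u2 u1] Us].
exists [seq w <- s1 | w \in F], [seq w <- s2 | w \in F].
have sub1 s : u \notin s ->
  [seq w <- s | w \in F :\ u] = [seq w <- s | w \in F].
  move=> us; apply: eq_in_filter => w ws; rewrite !inE.
  by case: eqP => // wu; rewrite -wu ws in us.
have idx w : enum_rank w = index w (s1 ++ u :: s2) :> nat.
  by rewrite enum_rank_index eV.
split; first by rewrite enum_filter eV filter_cat /= uF.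
  by rewrite enum_filter eV filter_cat /= !inE eqxx /= !sub1.
rewrite cardE enum_filter eV filter_cat /= !inE eqxx /= size_cat.
rewrite [X in (_ + X)%N](_ : _ = 0)%N ?addn0.
  congr size; apply: eq_in_filter => w w1; rewrite !inE !idx !index_cat w1.
  rewrite (negPf u1) /= eqxx addn0 index_mem w1 andbT.
  by case: eqP => // wu; rewrite -wu w1 in u1.
apply/eqP; rewrite size_eq0; apply/eqP; rewrite -(filter_pred0 s2).
apply: eq_in_filter => w w2; rewrite !inE !idx !index_cat.
have wu : (w == u) = false by apply/negP => /eqP wu; rewrite -wu w2 in u2.
have -> : w \in s1 = false.
  apply/negP => w1; move: Us; rewrite cat_uniq => /and3P[_ /hasP[]].
  by exists w.
by rewrite (negPf u1) /= eqxx wu addn0 ltnNge leq_addr andbF.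
Qed.

Lemma card_setD1 F u k : u \in F -> #|F| = k.+1 -> #|F :\ u| = k.
Proof. by move=> uF; rewrite (cardsD1 u) uF add1n => -[]. Qed.

Lemma subset_setD1 G F :
  G \subset F -> #|F| = #|G|.+1 -> exists2 v, v \in F & G = F :\ v.
Proof.
move=> GF cF; have [v] : exists v, v \in F :\: G.
  by apply/set0Pn; rewrite -card_gt0 cardsD (setIidPr GF) cF subSnn.
rewrite inE => /andP[vG vF]; exists v => //.
by apply/eqP; rewrite eqEcard subsetD1 GF vG /= (card_setD1 vF cF).
Qed.

Lemma extend_card H k : (#|H| <= k <= #|V|)%N ->
  exists2 X : {set V}, H \subset X & #|X| = k.
Proof.
case/andP=> Hk kV; have [m] := ubnP (k - #|H|); elim: m H Hk => // m IH H Hk km.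
have [kH|Hk'] := leqP k #|H|; first by exists H => //; apply/eqP;
  rewrite eqn_leq Hk.
have [v vH] : exists v, v \notin H.
  apply/existsP; rewrite -negb_forall; apply/negP => /forallP allH.
  move: Hk'; rewrite ltnNge; case/negP; apply: (leq_trans kV).
  by apply/subset_leq_card/subsetP => v _; apply: allH.
have cv : #|v |: H| = #|H|.+1 by rewrite cardsU1 vH.
have [||X sX cX] := IH (v |: H); rewrite ?cv //.
  by rewrite -subn_gt0 in Hk'; lia.
by exists X => //; apply: subset_trans sX; apply: subsetUr.
Qed.

End Sets.

Section Minors.
Variables (K : fieldType) (V : finType) (n : nat) (C : 'M[K]_(n.+1, #|V|)).
Implicit Types (F G H X : {set V}) (u v w : V) (q : 'I_n.+1 -> K).

Definition pt v : 'I_n.+1 -> K := fun i => C i (enum_rank v).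

(** The columns follow the enumeration of [X]; entries are taken from a list
    so that no default vertex is needed. The definition is meant for [#|X| =
    k]. *)
Definition colsub_of k X : 'M[K]_(n.+1, k) :=
  \matrix_(i, j) nth 0 [seq pt v i | v <- enum X] j.

Definition fdet F : K := \det (colsub_of n.+1 F).

(** The covector of K^d whose value at q is the determinant of q followed by
    the columns of [G]. *)
Definition conormal G (i : 'I_n.+1) : K :=
  (-1) ^+ i * \det (row' i (colsub_of n G)).

Lemma dotv_conormal G q :
  dotv (conormal G) q = \det (\matrix_(i < n.+1, j < n.+1)
    if unlift 0 j is Some k then colsub_of n G i k else q i).
Proof.
rewrite (expand_det_col _ 0); apply: eq_bigr => i _.
rewrite mxE unlift_none /cofactor addn0 mulrC /conormal;
  congr (_ * (_ * \det _)).
by apply/matrixP => a b; rewrite !mxE liftK mxE.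
Qed.

Lemma conormal_vertex G v : #|G| = n -> v \in G -> dotv (conormal G) (pt v) = 0.
Proof.
move=> cG vG.
have jn : (index v (enum G) < n)%N by rewrite -cG cardE index_mem mem_enum.
pose j := Ordinal jn.
rewrite dotv_conormal -det_tr (@determinant_alternate _ _ _ 0 (lift 0 j)) //.
  by move=> i; rewrite !mxE unlift_none liftK mxE (nth_map v) ?nth_index
    ?mem_enum // -cardE cG.
Qed.

(** Expansion of the determinant of [F] along the column of [u]. *)
Lemma conormal_facet F u : #|F| = n.+1 -> u \in F ->
  dotv (conormal (F :\ u)) (pt u) =
  (-1) ^+ #|[set w in F :\ u | (enum_rank w < enum_rank u)%N]| * fdet F.
Proof.
move=> cF uF; have [s1 [s2 [eF eFu s1E]]] := enum_setD1 uF.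
have kn : (size s1 < n.+1)%N.
  by rewrite -cF cardE eF size_cat /= addnS ltnS leq_addr.
pose k := Ordinal kn.
rewrite -s1E /fdet (expand_det_col _ k) mulr_sumr; apply: eq_bigr => i _.
rewrite mxE eF map_cat nth_cat size_map /= ltnn subnn /=.
rewrite /cofactor exprD /conormal -/(pt u i).
rewrite (_ : row' i (col' k _) = row' i (colsub_of n (F :\ u))).
  set D := \det _; have e1 : (-1) ^+ size s1 * (-1) ^+ size s1 = 1 :> K.
    by rewrite -expr2 sqrr_sign.
  transitivity ((-1) ^+ size s1 * (-1) ^+ size s1 * ((-1) ^+ i * D * pt u i)).
    by rewrite e1 mul1r.
  rewrite -[nat_of_ord k]/(size s1); ring.
apply/matrixP => a b;
  rewrite !mxE eF eFu !map_cat /= !nth_cat !size_map /= /bump.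
have [b1|b1] := ltnP b (size s1); first by rewrite add0n b1.
by rewrite add1n ltnNge (leqW b1) /= subSn.
Qed.

Lemma incidence_setD1 F w : w \in F ->
  incidence K (F :\ w) F =
  (-1) ^+ #|[set x in F :\ w | (enum_rank x < enum_rank w)%N]|.
Proof.
move=> wF; rewrite /incidence (big_pred1 w) // => v /=.
apply/andP/eqP => [[vF /eqP E]|->]; last by [].
by apply/eqP/negP => vw; have := setD11 v F; rewrite -E !inE vF; case/andP;
  split=> //; apply/negP.
Qed.

Definition scaled_inc G F : K := incidence K G F * fdet F.

Lemma scaled_inc_setD1 F w : #|F| = n.+1 -> w \in F ->
  scaled_inc (F :\ w) F = dotv (conormal (F :\ w)) (pt w).
Proof. by move=> cF wF;
  rewrite /scaled_inc incidence_setD1 ?conormal_facet. Qed.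

Hypothesis general : forall F, #|F| = n.+1 -> fdet F != 0.

Lemma conormal_neq0 F u : #|F| = n.+1 -> u \in F ->
  dotv (conormal (F :\ u)) (pt u) != 0.
Proof. by move=> cF uF;
  rewrite conormal_facet // mulf_neq0 ?signr_eq0 ?general. Qed.

(** Cramer's rule: the coordinate of [q] along the column of [u] in the basis
    given by the columns of [F]. *)
Definition coord_of F u q : K :=
  dotv (conormal (F :\ u)) q / dotv (conormal (F :\ u)) (pt u).

Lemma coord_of_vertex F u v : #|F| = n.+1 -> u \in F -> v \in F ->
  coord_of F u (pt v) = (v == u)%:R.
Proof.
move=> cF uF vF; rewrite /coord_of; case: eqP => [->|/eqP vu].
  by rewrite divff ?conormal_neq0.
rewrite conormal_vertex ?mul0r // ?inE ?vu //.
exact: card_setD1.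
Qed.

Lemma coord_of_unique F c q v : #|F| = n.+1 -> v \in F ->
  (forall i, q i = \sum_(u in F) c u * pt u i) -> coord_of F v q = c v.
Proof.
move=> cF vF qE; rewrite /coord_of; set a := conormal _.
have -> : dotv a q = \sum_(u in F) c u * dotv a (pt u).
  rewrite /dotv; under eq_bigr => i _ do rewrite qE mulr_sumr.
  rewrite exchange_big; apply: eq_bigr => u _; rewrite mulr_sumr.
  by apply: eq_bigr => i _; rewrite mulrCA.
rewrite mulr_suml (bigD1 v) //= -mulrA -/(coord_of F v (pt v)).
rewrite coord_of_vertex // eqxx mulr1 big1 ?addr0 // => u /andP[uF uv].
by rewrite -mulrA -/(coord_of F v (pt u)) coord_of_vertex // (negPf uv) mulr0.
Qed.

Lemma coord_of_span F q i : #|F| = n.+1 ->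
  q i = \sum_(u in F) coord_of F u q * pt u i.
Proof.
move=> cF.
have uF : colsub_of n.+1 F \in unitmx by rewrite unitmxE unitfE general.
pose x := invmx (colsub_of n.+1 F) *m \col_i q i.
pose c u := if insub (index u (enum F)) is Some k then x k 0 else 0.
have qE j : q j = \sum_(u in F) c u * pt u j.
  have -> : q j = (colsub_of n.+1 F *m x) j 0 by rewrite mulKVmx // mxE.
  have sz : size (enum F) = n.+1 by rewrite -cardE.
  rewrite mxE; under eq_bigr => k _ do rewrite [colsub_of _ _ _ _]mxE.
  rewrite -[RHS]big_enum /=;
    case: (enum F) sz (enum_uniq F) @c => // u0 s sz us c.
  rewrite (big_nth u0) sz big_mkord; apply: eq_bigr => k _.
  rewrite (nth_map u0) ?sz // mulrC /c index_uniq ?sz // valK //.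
by rewrite {1}qE; apply: eq_bigr => u Fu; rewrite (coord_of_unique cF Fu qE).
Qed.

End Minors.

(** * Monomials and squarefree reduction in the face ring *)

Section Ideals.
Variable R : comNzRingType.

Lemma in_ideal_lin (I : finType) (P : pred I) (g : I -> R) c x y :
  in_ideal P g x -> in_ideal P g y -> in_ideal P g (c * x + y).
Proof.
case=> a -> [b ->]; exists (fun i => c * a i + b i).
by rewrite mulr_sumr -big_split; apply: eq_bigr => i _; rewrite mulrDl mulrA.
Qed.

Lemma in_ideal0 (I : finType) (P : pred I) (g : I -> R) : in_ideal P g 0.
Proof. by exists (fun=> 0); rewrite big1 // => i _; rewrite mul0r. Qed.

Lemma in_ideal_gen (I : finType) (P : pred I) (g : I -> R) i c :
  P i -> in_ideal P g (c * g i).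
Proof.
move=> Pi; exists (fun j => if j == i then c else 0).
rewrite (bigD1 i) //= eqxx big1 ?addr0 // => j /andP[_ /negPf ->].
by rewrite mul0r.
Qed.

Lemma in_sigma_lin d (theta : 'I_d -> R) c x y :
  in_sigma theta x -> in_sigma theta y -> in_sigma theta (c * x + y).
Proof.
case=> u [v [hu hv ->]] [u' [v' [hu' hv' ->]]].
exists (c * u + u'), (fun i => c * v i + v' i); split.
- exact: in_ideal_lin.
- by move=> i; rewrite mulrDr mulrCA; apply: in_ideal_lin.
- by rewrite big_split -mulr_sumr mulrDr addrACA.
Qed.

Lemma in_ideal_sigma d (theta : 'I_d -> R) x :
  in_ideal predT theta x -> in_sigma theta x.
Proof.
move=> hx; exists x, (fun=> 0); split=> //; last by rewrite big1_eq addr0.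
by move=> i; rewrite mulr0; apply: in_ideal0.
Qed.

Lemma in_sigmaB d (theta : 'I_d -> R) x y :
  in_sigma theta x -> in_sigma theta y -> in_sigma theta (x - y).
Proof. by move=> hx hy; rewrite addrC -mulN1r; apply: in_sigma_lin. Qed.

Lemma in_sigmaD d (theta : 'I_d -> R) x y :
  in_sigma theta x -> in_sigma theta y -> in_sigma theta (x + y).
Proof. by move=> hx hy; rewrite -[x]mul1r; apply: in_sigma_lin. Qed.

End Ideals.

Section Monomials.
Variables (K : fieldType) (V : finType).
Notation A := {mpoly K[#|V|]}.
Implicit Types (F G H : {set V}) (m : 'X_{1..#|V|}).

Definition mset m : {set V} := [set v | m (enum_rank v) != 0%N].

Definition sqfree_mnm F : 'X_{1..#|V|} := (\sum_(v in F) U_(enum_rank v))%MM.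

Lemma xmonE F : xmon K F = 'X_[sqfree_mnm F].
Proof. by rewrite /xmon /sqfree_mnm; elim/big_rec2: _ => [|v a b _ ->];
  rewrite ?mpolyX0 // mpolyXD. Qed.

Lemma sqfree_mnmE F v : sqfree_mnm F (enum_rank v) = (v \in F).
Proof.
rewrite /sqfree_mnm mnm_sumE; case: (boolP (v \in F)) => vF; last first.
  rewrite big1 // => u uF; rewrite mnm1E (inj_eq enum_rank_inj).
  by case: eqP => // uv; rewrite -uv uF in vF.
rewrite (bigD1 v) //= mnm1E eqxx big1 // => u /andP[_ uv].
by rewrite mnm1E (inj_eq enum_rank_inj) (negPf uv).
Qed.

Lemma mset_sqfree F : mset (sqfree_mnm F) = F.
Proof. by apply/setP => v; rewrite inE sqfree_mnmE; case: (v \in F). Qed.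

Lemma mdeg_sqfree F : mdeg (sqfree_mnm F) = #|F|.
Proof.
rewrite /sqfree_mnm mdeg_sum -[RHS]sum1_card.
by apply: eq_bigr => v _; rewrite mdeg1.
Qed.

Lemma xmon_homog F : xmon K F \is #|F|.-homog.
Proof. by rewrite xmonE dhomogX; apply/eqP/mdeg_sqfree. Qed.

Lemma mnmP_rank m m' : (forall v, m (enum_rank v) = m' (enum_rank v)) -> m = m'.
Proof. by move=> E; apply/mnmP => i; rewrite -(enum_valK i). Qed.

Lemma sqfree_mset m : (forall v, m (enum_rank v) <= 1)%N ->
  m = sqfree_mnm (mset m).
Proof.
move=> m1; apply: mnmP_rank => v; rewrite sqfree_mnmE inE.
by move: (m1 v); rewrite leq_eqVlt ltnS leqn0 => /orP[] /eqP ->.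
Qed.

Lemma mset_addU m v : mset (m + U_(enum_rank v))%MM = v |: mset m.
Proof.
apply/setP => u; rewrite !inE mnmDE mnm1E (inj_eq enum_rank_inj) [v == u]eq_sym.
by case: (u == v); rewrite ?addn1 ?addn0.
Qed.

Lemma xmon_setU1 F v : v \notin F ->
  xmon K (v |: F) = 'X_(enum_rank v) * xmon K F.
Proof. by move=> vF; rewrite /xmon big_setU1. Qed.

Lemma msetS m m' : mset m \subset mset (m + m')%MM.
Proof.
by apply/subsetP => v; rewrite !inE mnmDE addn_eq0 negb_and => ->.
Qed.

End Monomials.

Section FaceRingTheory.
Variables (K : fieldType) (V : finType) (Delta : complex V).
Notation A := {mpoly K[#|V|]}.
Implicit Types (F G H : {set V}) (m : 'X_{1..#|V|}).

Notation pi := (@SRpi K V Delta).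

HB.instance Definition _ := GRing.RMorphism.copy pi
  (\pi_({ideal_quot (SRidealr K Delta)})%qT : A -> SRring K Delta).

Lemma SRpi_eq0 (p : A) : pi p = 0 <-> SRideal Delta p.
Proof.
rewrite -[X in _ = X](rmorph0 pi) /SRpi; split.
  by move=> /eqP; rewrite -Quotient.idealrBE subr0.
by move=> hp; apply/eqP; rewrite -Quotient.idealrBE subr0.
Qed.

Lemma SRpi_repr (x : SRring K Delta) : pi (repr x) = x.
Proof. by rewrite /SRpi reprK. Qed.

Lemma SRideal_nonface m : mset m \notin Delta -> SRideal Delta ('X_[m] : A).
Proof.
move=> mD; apply/asboolP; have le : (sqfree_mnm (mset m) <= m)%MM.
  apply/mnm_lepP => i; rewrite -(enum_valK i) sqfree_mnmE inE.
  by case: (m _).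
rewrite -(submK le) mpolyXD -xmonE.
by apply: in_ideal_gen.
Qed.

(** All monomials of the ideal are nonface monomials; in particular the ideal
    is graded. *)
Lemma SRideal_mcoeff (r : A) m : SRideal Delta r -> mset m \in Delta ->
  r@_m = 0.
Proof.
move=> /asboolP[a ->] mD; rewrite raddf_sum big1 // => F FD.
rewrite [a F]mpolyE mulr_suml raddf_sum big1 // => k _ /=.
rewrite -scalerAl mcoeffZ xmonE -mpolyXD mcoeffX; case: eqP => [E|];
  last by rewrite mulr0.
case/negP: FD; apply: face_sub mD; rewrite -E addmC -{1}(mset_sqfree F).
exact: msetS.
Qed.

Lemma kfaces_setD1 k F u :
  F \in kfaces Delta k.+1 -> u \in F -> F :\ u \in kfaces Delta k.
Proof.
rewrite !inE => /andP[FD /eqP cF] uF.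
by rewrite (face_sub (subD1set F u) FD) (card_setD1 uF cF) /=.
Qed.

Section Reduction.
Variables (n : nat) (C : 'M[K]_(n.+1, #|V|)).
Hypotheses (dimD : dimS Delta = n.+1)
           (general : forall F, #|F| = n.+1 -> fdet C F != 0).

Lemma face_card F : F \in Delta -> (#|F| <= n.+1)%N.
Proof. by move=> FD; rewrite -dimD /dimS (bigD1 F) //= leq_maxl. Qed.

Lemma card_vertices : (n.+1 <= #|V|)%N.
Proof. by rewrite -dimD; apply/bigmax_leqP => F _; apply: max_card. Qed.

Lemma covector_form (a : 'I_n.+1 -> K) :
  \sum_i a i *: linform C i = \sum_v dotv a (pt C v) *: 'X_(enum_rank v).
Proof.
rewrite /linform; under eq_bigr => i _ do rewrite scaler_sumr.
rewrite exchange_big (reindex_onto enum_rank enum_val) /=; last by move=> i _;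
  rewrite enum_valK.
apply: eq_big => [v|v _]; first by rewrite enum_rankK eqxx.
by rewrite /dotv scaler_suml; apply: eq_bigr => i _; rewrite scalerA.
Qed.

(** Any [n.+1] columns are independent, hence so are those of a face, which
    extends to a set of [n.+1] vertices (not necessarily a face). *)
Lemma face_covector F v : F \in Delta -> v \in F ->
  exists a : 'I_n.+1 -> K, forall u, u \in F -> dotv a (pt C u) = (u == v)%:R.
Proof.
move=> FD vF; have [X FX cX] : exists2 X : {set V}, F \subset X & #|X| = n.+1.
  by apply: extend_card; rewrite face_card // card_vertices.
have vX := subsetP FX v vF.
exists (fun i => conormal C (X :\ v) i / dotv (conormal C (X :\ v)) (pt C v)) =>
  u uF.
rewrite -(coord_of_vertex general cX vX (subsetP FX u uF)) /coord_of /dotv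
  mulr_suml.
by apply: eq_bigr => i _; rewrite mulrAC.
Qed.

(** Multiplying a monomial by the combination of the forms given by
    [face_covector] trades a repeated variable for variables outside the
    support, so monomials reach squarefree or nonface ones by induction on the
    size of the complement of their support. The predicate [N] is arbitrary so
    that the same induction serves membership in ideals and vanishing of
    functionals. *)
Lemma squarefree_reduction (N : A -> Prop) e :
    N 0 -> (forall c f g, N f -> N g -> N (c *: f + g)) ->
    (forall m, mdeg m = e -> mset m \notin Delta -> N 'X_[m]) ->
    (forall i m, (mdeg m).+1 = e -> N (linform C i * 'X_[m])) ->
    (forall G, G \in Delta -> #|G| = e -> N (xmon K G)) ->
  forall f : A, f \is e.-homog -> N f.
Proof.
move=> N0 Nlin Nnon Ntheta Nsq.
have Nsum (I : finType) (P : pred I) (c : I -> K) (F : I -> A) :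
    (forall i, P i -> N (F i)) -> N (\sum_(i | P i) c i *: F i).
  by move=> NF; elim/big_rec: _ => // i x Pi Nx; apply/Nlin/Nx/NF.
suff NX m : mdeg m = e -> N 'X_[m].
  move=> f /dhomogP hf; rewrite [f]mpolyE big_seq.
  by elim/big_rec: _ => // m x mf Nx; apply/Nlin/Nx/NX/hf.
have [k] := ubnP (#|V| - #|mset m|); elim: k m => // k IH m mk me.
have [mD|] := boolP (mset m \in Delta); last exact: Nnon.
have [/forallP m1|] := boolP [forall v, m (enum_rank v) <= 1]%N.
  by rewrite (sqfree_mset m1) -xmonE; apply: Nsq => //;
    rewrite -me {2}(sqfree_mset m1) mdeg_sqfree.
rewrite negb_forall => /existsP[v]; rewrite -ltnNge => mv.
have vm : v \in mset m by rewrite inE -lt0n ltnW.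
have le : (U_(enum_rank v) <= m)%MM.
  by apply/mnm_lepP => i; rewrite mnm1E; case: eqP => // <-; apply: ltnW.
set m' := (m - U_(enum_rank v))%MM;
  have mE : m = (m' + U_(enum_rank v))%MM by rewrite submK.
have sm : mset m' = mset m.
  apply/setP => u; rewrite !inE mnmBE mnm1E (inj_eq enum_rank_inj).
  by case: (v =P u) => [<-|_]; rewrite ?subn0 // -!lt0n subn_gt0 mv ltnW.
have dm' : (mdeg m').+1 = e by rewrite -me mE mdegD mdeg1 addn1.
have [a aE] := face_covector mD vm.
(* Among the variables of H only x_v survives in the combination of forms. *)
have XE : 'X_[m] = \sum_i a i *: (linform C i * 'X_[m']) +
    - \sum_(w | w \notin mset m)
        dotv a (pt C w) *: 'X_[m' + U_(enum_rank w)] :> A.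
  under eq_bigr => i _ do rewrite scalerAl.
  rewrite -mulr_suml covector_form (bigID (mem (mset m))) /= mulrDl.
  rewrite (bigD1 v) //= aE // eqxx scale1r big1 ?addr0; last first.
    by move=> u /andP[um uv]; rewrite aE // (negPf uv) scale0r.
  rewrite -mpolyXD addmC -mE mulr_suml -sumrN -[LHS]addr0 -addrA; congr (_ + _).
  rewrite -big_split /= big1 // => w _.
  by rewrite -scalerAl -mpolyXD [(_ + m')%MM]addmC subrr.
rewrite XE -sumrN; under [X in _ + X]eq_bigr => w _ do rewrite -scaleNr.
rewrite -[X in X + _]scale1r; apply: Nlin; first by apply: Nsum => i _;
  apply: Ntheta.
apply: Nsum => w wm; apply: IH; last by rewrite mdegD mdeg1 addn1.
rewrite mset_addU sm cardsU1 wm /=.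
have : (#|mset m| < #|V|)%N.
  rewrite ltn_neqAle max_card andbT; apply: contra wm => /eqP E.
  have /eqP -> : mset m == setT by rewrite eqEcard subsetT cardsT E /=.
  by rewrite in_setT.
by move=> lt; rewrite add1n subnS prednK ?subn_gt0.
Qed.

End Reduction.
End FaceRingTheory.

(** * Syzygies of the linear forms and sums over fibres *)

(** Both sides range over the pairs of a set [F] and an element [v] removed
    from it. *)
Lemma sum_pairs_setU1 (R : nmodType) (V : finType) (P : pred {set V})
    (f : {set V} -> V -> R) :
  \sum_(G | P G) \sum_(v | v \notin G) f G v =
  \sum_(F : {set V}) \sum_(v | (v \in F) && P (F :\ v)) f (F :\ v) v.
Proof.
rewrite !pair_big_dep /=.
rewrite (reindex_onto (fun p : {set V} * V => (p.1 :\ p.2, p.2))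
  (fun p => (p.2 |: p.1, p.2))) /=.
  apply: eq_bigl => -[F v] /=; rewrite setD11 andbT xpair_eqE eqxx andbT.
  rewrite andbC; congr (_ && _); apply/eqP/idP => [<-|/setD1K //].
  by rewrite setU11.
by move=> [G v] /= /andP[_ vG]; rewrite setU1K.
Qed.

Section SigmaModule.
Variables (K : fieldType) (V : finType) (Delta : complex V) (n : nat)
  (C : 'M[K]_(n.+1, #|V|)).
Hypotheses (dimD : dimS Delta = n.+1)
           (general : forall F : {set V}, #|F| = n.+1 -> fdet C F != 0).
Notation A := {mpoly K[#|V|]}.
Implicit Types (F G H : {set V}) (m : 'X_{1..#|V|}) (f : A) (q : 'I_n.+1 -> K).

Notation pi := (@SRpi K V Delta).
Notation pt := (pt C).
Notation conormal := (conormal C).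
Notation coord_of := (coord_of C).

Lemma pi_scale (c : K) f : pi (c *: f) = pi c%:MP * pi f.
Proof. by rewrite -mul_mpolyC rmorphM. Qed.

Lemma pi_nonface F : F \notin Delta -> pi (xmon K F) = 0.
Proof. by move=> FD; apply/SRpi_eq0; rewrite xmonE; apply: SRideal_nonface;
  rewrite mset_sqfree. Qed.

(** For each [i] the elements [a i j] defined in the proof form a syzygy of
    the linear forms as [j] varies: the coefficient of a facet monomial is the
    hypothesis on [y], and the other monomials vanish in the face ring. Hence
    [a i i] is in Sigma, and the conclusion is the sum of these over [i]. *)
Lemma sigma_of_cocycle (y : {set V} -> 'I_n.+1 -> K) :
    (forall F i, F \in kfaces Delta n.+1 ->
       \sum_(u in F) scaled_inc C (F :\ u) F * y (F :\ u) i = 0) ->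
  in_sigma (SRforms Delta C)
    (pi (\sum_(G in kfaces Delta n) dotv (conormal G) (y G) *: xmon K G)).
Proof.
move=> ycyc.
pose a i j : A := \sum_(G in kfaces Delta n) (y G i * conormal G j) *: xmon K G.
have syz i : \sum_j SRforms Delta C j * pi (a i j) = 0.
  under eq_bigr => j _ do rewrite -rmorphM.
  rewrite -rmorph_sum.
  have -> : \sum_j linform C j * a i j =
      \sum_(G in kfaces Delta n) \sum_(v | v \notin G)
        (y G i * dotv (conormal G) (pt v)) *: xmon K (v |: G).
    under eq_bigr => j _ do rewrite mulr_sumr.
    rewrite exchange_big; apply: eq_bigr => G; rewrite inE => /andP[_ /eqP cG].
    transitivity (y G i *: ((\sum_j conormal G j *: linform C j) * xmon K G)).
      rewrite mulr_suml scaler_sumr; apply: eq_bigr => j _.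
      by rewrite -scalerAl -scalerAr scalerA.
    rewrite covector_form (bigID (mem G)) /= big1 ?add0r => [|v vG]; last first.
      by rewrite conormal_vertex // scale0r.
    rewrite mulr_suml scaler_sumr; apply: eq_bigr => v vG.
    by rewrite -scalerAl scalerA xmon_setU1.
  rewrite sum_pairs_setU1 rmorph_sum big1 // => F _.
  have [FD|FD] := boolP (F \in Delta); last first.
    rewrite rmorph_sum big1 // => v /andP[vF _].
    by rewrite /= setD1K // pi_scale pi_nonface // mulr0.
  have [cF|cF] := eqVneq #|F| n.+1; last first.
    rewrite big_pred0 ?rmorph0 // => v; apply/negP => /andP[vF].
    by rewrite inE => /andP[_ /eqP cFv]; rewrite (cardsD1 v) vF cFv eqxx in cF.
  rewrite (_ : \sum_(v | _) _ =
    (\sum_(u in F) scaled_inc C (F :\ u) F * y (F :\ u) i) *: xmon K F).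
    by rewrite ycyc ?scale0r ?rmorph0 // inE FD cF eqxx.
  rewrite scaler_suml; apply: eq_big => [v|v /andP[vF _]].
    apply: andb_idr => vF; rewrite inE (face_sub (subD1set F v)) //=.
    by rewrite (card_setD1 vF cF).
  by rewrite setD1K // scaled_inc_setD1 // mulrC.
exists 0, (fun i => pi (a i i)); split; first exact: in_ideal0.
  move=> i; exists (fun j => - pi (a i j)).
  have /eqP := syz i; rewrite (bigD1 i) //= addr_eq0 => /eqP ->.
  by rewrite -sumrN; apply: eq_bigr => j _; rewrite mulrC mulNr.
rewrite add0r -rmorph_sum; congr (pi _); rewrite exchange_big.
apply: eq_bigr => G _; rewrite -scaler_suml; congr (_ *: _).
by apply: eq_bigr => i _; rewrite mulrC.
Qed.

(** The point above such a [q] in the coordinate plane of a facet has no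
    further zero coordinate, because its coordinates are values of conormals
    at [q] up to nonzero factors. *)
Definition generic q := forall X : {set V}, #|X| = n ->
  dotv (conormal X) q != 0.

Lemma conormal_nonzero (X : {set V}) : #|X| = n -> exists i, conormal X i != 0.
Proof.
move=> cX; have [Y XY cY] : exists2 Y : {set V}, X \subset Y & #|Y| = n.+1.
  by apply: extend_card; rewrite cX leqnSn; apply: card_vertices dimD.
have [v vY XE] := subset_setD1 XY (etrans cY (congr1 S (esym cX))).
apply/existsP; rewrite -negb_forall; apply/negP => /forallP c0.
have := conormal_neq0 general cY vY; rewrite -XE /dotv big1 ?eqxx // => i _.
by rewrite (eqP (c0 i)) mul0r.
Qed.

(** The conormals as a family indexed by all sets of vertices; the values
    outside sets with d - 1 elements are padding. *)
Definition generic_family (X : {set V}) : 'I_n.+1 -> K :=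
  if #|X| == n then conormal X else fun=> 1.

Lemma generic_family_neq0 X : exists i, generic_family X i != 0.
Proof.
rewrite /generic_family; case: eqP => [/conormal_nonzero //|_].
by exists ord0; rewrite oner_eq0.
Qed.

Lemma generic_familyP q : (forall X, dotv (generic_family X) q != 0) ->
  generic q.
Proof. by move=> gq X cX; have := gq X; rewrite /generic_family cX eqxx. Qed.

Hypothesis K_infinite : forall s : seq K, exists x : K, x \notin s.

Lemma generic_exists : exists q, generic q.
Proof.
have [q gq] := avoid_hyperplanes K_infinite generic_family_neq0.
by exists q; apply: generic_familyP.
Qed.

Lemma generic_form_eq0 (L : 'I_n.+1 -> K) :
  (forall q, generic q -> dotv L q = 0) -> forall i, L i = 0.
Proof.
move=> L0; apply: (dotv_generic_eq0 K_infinite generic_family_neq0) => q gq.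
by apply/L0/generic_familyP.
Qed.

Section Residue.
Variables (s : {set V} -> 'I_n.+1 -> K) (t : {set V} -> K).
Hypothesis st : forall G i, G \in kfaces Delta n ->
  t G * conormal G i = \sum_(F in kfaces Delta n.+1) scaled_inc C G F * s F i.

(** The point above [q] in the coordinate plane of the facet [F], at which the
    linear forms take the values [q]. *)
Definition lift_point F q (j : 'I_#|V|) : K :=
  if enum_val j \in F then coord_of F (enum_val j) q else 0.

(** Weights with the product of the coordinates in the denominator are those
    of a localization formula: individual terms have poles along the
    hyperplanes spanned by ridges, and the relation between [s] and [t] makes
    the poles cancel. *)
Definition trace q f : K := \sum_(F in kfaces Delta n.+1)
  dotv (s F) q / (\prod_(u in F) coord_of F u q) * f.@[lift_point F q].

Lemma trace_is_scalar q : scalar (trace q).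
Proof.
move=> c f g; rewrite /trace mulr_sumr -big_split; apply: eq_bigr => F _.
by rewrite mevalD mevalZ mulrDr mulrCA.
Qed.

HB.instance Definition _ q :=
  GRing.isLinear.Build K A K *%R (trace q) (trace_is_scalar q).

Lemma lift_point_rank F q v :
  lift_point F q (enum_rank v) = if v \in F then coord_of F v q else 0.
Proof. by rewrite /lift_point enum_rankK. Qed.

Lemma meval_xmon F q G : ~~ (G \subset F) -> (xmon K G).@[lift_point F q] = 0.
Proof.
case/subsetPn => v vG vF; rewrite /xmon (bigD1 v) //= mevalM mevalXU.
by rewrite lift_point_rank (negPf vF) mul0r.
Qed.

Lemma trace_SRideal q f : SRideal Delta f -> trace q f = 0.
Proof.
move=> /asboolP[a ->]; rewrite /trace big1 // => F; rewrite inE => /andP[FD _].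
rewrite raddf_sum /= [X in _ * X]big1 ?mulr0 // => G GD;
  rewrite mevalM meval_xmon ?mulr0 //.
by apply: contra GD => GF; apply: face_sub FD.
Qed.

Lemma trace_linform q j f : trace q (linform C j * f) = q j * trace q f.
Proof.
rewrite /trace mulr_sumr; apply: eq_bigr => F; rewrite inE => /andP[FD /eqP cF].
rewrite mevalM mulrCA; congr (_ * _); rewrite raddf_sum /=.
rewrite (coord_of_span general q j cF) (reindex enum_rank) /=; last first.
  by apply: onW_bij; apply: enum_rank_bij.
rewrite [RHS]big_mkcond; apply: eq_bigr => v _.
rewrite mevalZ mevalXU lift_point_rank mulrC.
by case: ifP; rewrite ?mul0r.
Qed.

Lemma scaled_inc_eq0 G F : (forall v, v \in F -> G <> F :\ v) ->
  scaled_inc C G F = 0.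
Proof.
move=> GF; rewrite /scaled_inc /incidence big_pred0 ?mul0r // => v.
by apply/negP => /andP[vF /eqP]; apply: GF.
Qed.

(** All but one of the coordinates in the denominator of each term cancel, and
    the remaining one is a quotient of values of the conormal of [G]; the
    relation [st] then adds up the terms. *)
Lemma trace_ridge q G : generic q -> G \in kfaces Delta n ->
  trace q (xmon K G) = t G.
Proof.
move=> gq Gr.
have [GD /eqP cG] : G \in Delta /\ #|G| == n by apply/andP; rewrite inE in Gr.
rewrite -[RHS](mulfK (gq G cG)) /dotv mulr_sumr.
under [in RHS]eq_bigr => i _ do rewrite mulrA st //.
under [in RHS]eq_bigr => i _ do rewrite mulr_suml.
rewrite exchange_big mulr_suml; apply: eq_bigr => F;
  rewrite inE => /andP[FD /eqP cF].
rewrite (_ : \sum_i _ = scaled_inc C G F * dotv (s F) q); last first.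
  by rewrite /dotv mulr_sumr; apply: eq_bigr => i _; rewrite mulrA.
have [GF|GF] := boolP (G \subset F); last first.
  rewrite meval_xmon // mulr0 scaled_inc_eq0 ?mul0r // => v vF GE.
  by rewrite GE subD1set in GF.
have [v vF GE] := subset_setD1 GF (etrans cF (congr1 S (esym cG))).
rewrite [in scaled_inc _ _ _]GE scaled_inc_setD1 // (big_setD1 v) //= -GE.
have -> : (xmon K G).@[lift_point F q] = \prod_(u in G) coord_of F u q.
  rewrite /xmon rmorph_prod; apply: eq_bigr => u uG.
  by rewrite /= mevalXU lift_point_rank (subsetP GF).
have nz u : u \in F -> coord_of F u q != 0.
  move=> uF; rewrite /coord_of mulf_neq0 ?invr_neq0 ?conormal_neq0 ?gq //.
  exact: card_setD1.
have pnz : \prod_(u in G) coord_of F u q != 0.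
  by apply/prodf_neq0 => u uG; rewrite nz // (subsetP GF).
rewrite invfM mulrA mulfVK // /coord_of -GE invf_div.
by rewrite mulrA [_ * dotv _ q]mulrC.
Qed.

Definition ridge_value G : K := if G \in Delta then t G else 0.

Lemma trace_card_ridge q G : generic q -> #|G| = n ->
  trace q (xmon K G) = ridge_value G.
Proof.
move=> gq cG; rewrite /ridge_value; case: ifPn => GD.
  by rewrite trace_ridge // inE GD cG eqxx.
by rewrite trace_SRideal // xmonE SRideal_nonface // mset_sqfree.
Qed.

Lemma trace_covector q a H : (forall u, u \in H -> dotv a (pt u) = 0) ->
  dotv a q * trace q (xmon K H) =
  \sum_(v | v \notin H) dotv a (pt v) * trace q (xmon K (v |: H)).
Proof.
move=> aH; transitivity (trace q ((\sum_i a i *: linform C i) * xmon K H)).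
  rewrite mulr_suml [in RHS]mulr_suml linear_sum; apply: eq_bigr => i _ /=.
  by rewrite -scalerAl linearZ /= trace_linform mulrA.
rewrite covector_form (bigID (mem H)) /= big1 ?add0r => [|v vH]; last first.
  by rewrite aH // scale0r.
rewrite mulr_suml linear_sum; apply: eq_bigr => v vH /=.
by rewrite -scalerAl linearZ /= xmon_setU1.
Qed.

(** Descending induction on [#|H|]. A covector vanishing on the columns of [H]
    expresses a multiple of the trace of [H] through traces of sets with one
    more element. These vanish by induction, unless [H] is just below the
    ridges, where they are constants: then two independent covectors would
    have proportional values at all generic points, unless these constants are
    zero. *)
Lemma trace_low_squarefree q H : generic q -> (#|H| < n)%N ->
  trace q (xmon K H) = 0.
Proof.
move=> gq Hn; have [k] := ubnP (n - #|H|).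
elim: k H Hn => // k IH H Hn nk.
have [X HX cX] : exists2 X : {set V}, H \subset X & #|X| = n.+1.
  by apply: extend_card; rewrite (leq_trans (ltnW Hn)) ?leqnSn //;
    apply: card_vertices dimD.
have : (1 < #|X :\: H|)%N by rewrite cardsD (setIidPr HX) cX; lia.
case/card_gt1P => a [b [+ + ab]]; rewrite !inE => /andP[aH aX] /andP[bH bX].
have cD u : u \in X -> #|X :\ u| = n by move=> uX; apply: card_setD1.
have vanish c u : c \notin H -> c \in X -> u \in H ->
  dotv (conormal (X :\ c)) (pt u) = 0.
  move=> cH cX' uH; apply: conormal_vertex; first exact: cD.
  rewrite !inE (subsetP HX) // andbT; apply: contraNneq cH => <- //.
have tr r c : generic r -> c \notin H -> c \in X ->
    dotv (conormal (X :\ c)) r * trace r (xmon K H) = \sum_(v | v \notin H)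
      dotv (conormal (X :\ c)) (pt v) * trace r (xmon K (v |: H)).
  by move=> gr cH cX'; apply: trace_covector => u; apply: vanish.
have aneq : dotv (conormal (X :\ a)) q != 0 by apply/gq/cD.
apply/eqP; rewrite -(mulrI_eq0 _ (mulfI aneq)); apply/eqP.
have [Hn1|Hn1] := ltnP #|H|.+1 n.
  rewrite tr // big1 // => v vH; rewrite IH ?mulr0 // cardsU1 vH //=.
  by move: nk; lia.
have {Hn1} Hn1 : #|H|.+1 = n by apply/eqP; rewrite eqn_leq Hn.
pose kappa c := \sum_(v | v \notin H) dotv (conormal (X :\ c)) (pt v) *
  ridge_value (v |: H).
(* Now each v |: H is a ridge or a nonface, so its trace is a constant. *)
have trk r c : generic r -> c \notin H -> c \in X ->
    dotv (conormal (X :\ c)) r * trace r (xmon K H) = kappa c.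
  move=> gr cH cX'; rewrite tr //; apply: eq_bigr => v vH.
  by rewrite trace_card_ridge // cardsU1 vH.
rewrite trk //.
(* The linear form kappa_a B - kappa_b A vanishes at all generic points, where A
   and B are the conormals of X - a and X - b; at p_b only B is nonzero. *)
pose L i := kappa a * conormal (X :\ b) i - kappa b * conormal (X :\ a) i.
have dotL r : dotv L r = kappa a * dotv (conormal (X :\ b)) r - kappa b *
  dotv (conormal (X :\ a)) r.
  rewrite /dotv !mulr_sumr -sumrB; apply: eq_bigr => i _.
  by rewrite mulrBl !mulrA.
have L0 i : L i = 0.
  apply: generic_form_eq0 => r gr; rewrite dotL -(trk r a) // -(trk r b) //;
    ring.
have := dotL (pt b); rewrite {1}/dotv big1 => [|i _]; last by rewrite L0 mul0r.
rewrite (@conormal_vertex _ _ _ _ (X :\ a)) ?cD //;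
  last by rewrite !inE eq_sym ab.
rewrite mulr0 subr0 => /esym/eqP; rewrite mulf_eq0 => /orP[/eqP //|].
by rewrite (negPf (conormal_neq0 general cX bX)).
Qed.

Lemma trace_low q f e : generic q -> (e < n)%N -> f \is e.-homog ->
  trace q f = 0.
Proof.
move=> gq; elim/ltn_ind: e f => e IH f en.
apply: (squarefree_reduction dimD general (N := fun f => trace q f = 0)).
- exact: linear0.
- by move=> c g h g0 h0; rewrite linearP /= g0 h0 mulr0 addr0.
- by move=> m _ mD; apply/trace_SRideal/SRideal_nonface.
- move=> i m me.
  have hm : ('X_[m] : A) \is (mdeg m).-homog by rewrite dhomogX eqxx.
  have lt : (mdeg m < e)%N by rewrite -me.
  by rewrite trace_linform (IH _ lt _ (ltn_trans lt en) hm) mulr0.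
- by move=> G GD cG; apply: trace_low_squarefree => //; rewrite cG.
Qed.

Lemma trace_generic q q' f : generic q -> generic q' -> f \is n.-homog ->
  trace q f = trace q' f.
Proof.
move=> gq gq'; apply: (squarefree_reduction dimD general
  (N := fun f => trace q f = trace q' f)).
- by rewrite !linear0.
- by move=> c g h g0 h0; rewrite !linearP /= g0 h0.
- by move=> m _ mD; rewrite !trace_SRideal ?SRideal_nonface.
- move=> i m me.
  have hm : ('X_[m] : A) \is (mdeg m).-homog by rewrite dhomogX eqxx.
  have lt : (mdeg m < n)%N by rewrite -me.
  by rewrite !trace_linform (trace_low gq lt hm) (trace_low gq' lt hm) !mulr0.
- by move=> G GD cG; rewrite !trace_card_ridge.
Qed.

End Residue.
End SigmaModule.

(** * The sigma quotient in degree d - 1 *)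

Section FaceFunctions.
Variables (K : fieldType) (V : finType).
Implicit Types (F G : {set V}) (D : {set {set V}}).

Definition extend D (y : 'I_#|D| -> K) G : K :=
  \sum_(g | enum_val g == G) y g.

Lemma extend_val D (y : 'I_#|D| -> K) g : extend y (enum_val g) = y g.
Proof. by rewrite /extend (big_pred1 g) // => k;
  rewrite (inj_eq enum_val_inj). Qed.

Lemma extend_lin D (b : K) (x y : 'rV[K]_#|D|) G :
  extend ((b *: x + y) 0) G = b * extend (x 0) G + extend (y 0) G.
Proof.
rewrite /extend mulr_sumr -big_split; apply: eq_bigr => g _.
by rewrite !mxE.
Qed.

Lemma sum_extend D (W : nmodType) (y : 'I_#|D| -> K) (h : K -> {set V} -> W) :
  \sum_(G in D) h (extend y G) G = \sum_g h (y g) (enum_val g).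
Proof.
rewrite (big_enum_val (fun G => h (extend y G) G)).
by apply: eq_bigr => g _; rewrite extend_val.
Qed.

Lemma sum_coboundary D k F (h : {set V} -> K) :
    #|F| = k.+1 -> (forall u, u \in F -> F :\ u \in D) ->
  \sum_(G in kfaces D k) incidence K G F * h G =
  \sum_(u in F) incidence K (F :\ u) F * h (F :\ u).
Proof.
move=> cF FD; have injD : {in F &, injective (fun u => F :\ u)}.
  move=> u v uF vF /= E; apply/eqP; apply: contraT => uv.
  by have := setD11 u F; rewrite E !inE uF uv.
rewrite -(big_imset (fun G => incidence K G F * h G) injD) /=.
rewrite (big_setID [set F :\ u | u in F]) /= [X in _ + X]big1 ?addr0 => [|G].
  apply: eq_bigl => G; rewrite inE; apply: andb_idl => /imsetP[u uF ->].
  by rewrite inE FD //= (card_setD1 uF cF).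
rewrite inE => /andP[GF _]; rewrite /incidence big_pred0 ?mul0r // => v.
apply: contraNF GF => /andP[vF /eqP ->]; exact: imset_f.
Qed.

Lemma mul_coboundary D k (y : 'rV[K]_#|kfaces D k|) (j : 'I_#|kfaces D k.+1|) :
    (forall u, u \in enum_val j -> enum_val j :\ u \in D) ->
  (y *m coboundary K D k) 0 j = \sum_(u in enum_val j)
    incidence K (enum_val j :\ u) (enum_val j) * extend (y 0) (enum_val j :\ u).
Proof.
move=> jD; have /[!inE]/andP[_ /eqP cj] := enum_valP j.
rewrite -(sum_coboundary (extend (y 0)) cj jD).
rewrite (sum_extend (y 0) (fun c G => incidence K G (enum_val j) * c)) mxE.
by apply: eq_bigr => g _; rewrite mxE mulrC.
Qed.

Definition face_cocycles D k : {vspace 'rV[K]_#|kfaces D k|} :=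
  lker (linfun (mulmxr (coboundary K D k) : _ -> 'rV_#|kfaces D k.+1|)).

Lemma face_cocyclesP D k (y : 'rV[K]_#|kfaces D k|) :
    (forall F u, F \in D -> F :\ u \in D) ->
  reflect (forall F, F \in kfaces D k.+1 ->
      \sum_(u in F) incidence K (F :\ u) F * extend (y 0) (F :\ u) = 0)
    (y \in face_cocycles D k).
Proof.
move=> Dsub; have mulE j := @mul_coboundary D k y j (fun u _ => Dsub _ u _).
have Dj (j : 'I_#|kfaces D k.+1|) : enum_val j \in D.
  by have /[!inE]/andP[] := enum_valP j.
rewrite memv_ker lfunE /=; apply: (iffP eqP) => [/rowP y0 F Fk|y0].
  by rewrite -(enum_rankK_in Fk Fk) -mulE ?y0 ?mxE.
by apply/rowP => j; rewrite mulE // mxE y0 ?enum_valP.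
Qed.

End FaceFunctions.

Section SigmaQuotient.
Variables (K : fieldType) (V : finType) (Delta : complex V) (n : nat)
  (C : 'M[K]_(n.+1, #|V|)).
Hypotheses (dimD : dimS Delta = n.+1)
           (general : forall F : {set V}, #|F| = n.+1 -> fdet C F != 0)
           (K_infinite : forall s : seq K, exists x : K, x \notin s).
Notation A := {mpoly K[#|V|]}.
Implicit Types (F G H : {set V}) (m : 'X_{1..#|V|}) (f : A) (q : 'I_n.+1 -> K).

Notation pi := (@SRpi K V Delta).
Notation theta := (SRforms Delta C).

Lemma linform_homog j : linform C j \is 1.-homog.
Proof. by apply: rpred_sum => i _; apply/rpredZ; rewrite dhomogX;
  apply/eqP/mdeg1. Qed.

Lemma pihomog_linform k j f :
  pihomog mdeg k (linform C j * f) = if k is k'.+1 then linform C j *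
    pihomog mdeg k' f else 0.
Proof.
rewrite [f in LHS]mpolyE [f in RHS]mpolyE !mulr_sumr !linear_sum /=.
transitivity (\sum_(m <- msupp f) if k is k'.+1 then
    linform C j * pihomog mdeg k' (f@_m *: 'X_[m]) else 0); last first.
  by case: k => [|k]; [rewrite big1_eq | rewrite linear_sum mulr_sumr].
apply: eq_bigr => m _; rewrite -scalerAr linearZ /=.
have hm : (linform C j * 'X_[m] : A) \is (mdeg m).+1.-homog.
  have hX : ('X_[m] : A) \is (mdeg m).-homog by rewrite dhomogX eqxx.
  exact: (dhomogM (linform_homog j) hX).
have [<-|km] := eqVneq (mdeg m).+1 k.
  by rewrite pihomog_dE // linearZ /= pihomogX eqxx scalerAr.
rewrite (pihomog_ne0 km hm) scaler0.
case: k km => // k km; rewrite linearZ /= pihomogX ifN ?scaler0 ?mulr0 //.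
Qed.

Section Vanishing.
Variables (s : {set V} -> 'I_n.+1 -> K) (t : {set V} -> K).
Hypothesis st : forall G i, G \in kfaces Delta n ->
  t G * conormal C G i = \sum_(F in kfaces Delta n.+1) scaled_inc C G F * s F i.
Notation tr := (trace Delta C s).

(** The ideal is graded, so the trace of a homogeneous component depends only
    on the class in the face ring; elements witnessing membership in Sigma
    need not be homogeneous. *)
Lemma trace_pihomog_SRideal k q f : SRideal Delta f ->
  tr q (pihomog mdeg k f) = 0.
Proof.
move=> fI; rewrite pihomogE linear_sum big1 // => m _ /=.
rewrite linearZ /=; have [mD|mD] := boolP (mset m \in Delta).
  by rewrite (SRideal_mcoeff fI mD) mul0r.
by rewrite trace_SRideal ?mulr0 //; apply: SRideal_nonface.
Qed.

Lemma trace_pihomog_sum k q (I : finType) (P : pred I) (F : I -> A) :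
  tr q (pihomog mdeg k (\sum_(i | P i) F i)) =
    \sum_(i | P i) tr q (pihomog mdeg k (F i)).
Proof. by rewrite (linear_sum (pihomog mdeg k)) (linear_sum (tr q)). Qed.

(** A relation between [theta i * v i] and the other forms becomes, after
    taking components of degree [n.+1] and traces, a linear relation between
    the coordinates of [q] with coefficients independent of [q], which are
    therefore zero. *)
Lemma trace_sigma q f : generic C q -> f \is n.-homog ->
  in_sigma theta (pi f) -> tr q f = 0.
Proof.
move=> gq fn [u [v [[a uE] hv fE]]].
have trE k r j g : tr r (pihomog mdeg k.+1 (linform C j * g)) = r j *
  tr r (pihomog mdeg k g).
  by rewrite pihomog_linform trace_linform.
have v0 i : tr q (pihomog mdeg n (repr (v i))) = 0.
  have [b hb] := hv i.
  pose L j := if j == i then tr q (pihomog mdeg n (repr (v i)))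
              else - tr q (pihomog mdeg n (repr (b j))).
  suff /(_ i) : forall j, L j = 0 by rewrite /L eqxx.
  apply: (generic_form_eq0 dimD general K_infinite) => r gr.
  have rI : SRideal Delta (linform C i *
    repr (v i) - \sum_(j | j != i) linform C j * repr (b j)).
    apply/SRpi_eq0; rewrite rmorphB rmorphM /= SRpi_repr [X in _ - X]rmorph_sum
      /=.
    rewrite -[pi (linform C i)]/(theta i) hb; apply/eqP; rewrite subr_eq0;
      apply/eqP.
    by apply: eq_bigr => j _; rewrite rmorphM /= SRpi_repr mulrC.
  have := trace_pihomog_SRideal n.+1 r rI.
  rewrite linearB linearB /= trE trace_pihomog_sum => E.
  rewrite /dotv (bigD1 i) //= /L eqxx -[RHS]E mulrC.
  rewrite (trace_generic dimD general K_infinite st gq gr (pihomogP _ _ _)).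
  rewrite -sumrN; congr (_ + _); apply: eq_bigr => j /negPf ->.
  by rewrite trE mulNr mulrC
    (trace_generic dimD general K_infinite st gq gr (pihomogP _ _ _)).
have rI : SRideal Delta
  (f - (\sum_j linform C j * repr (a j) + \sum_i repr (v i))).
  apply/SRpi_eq0; rewrite rmorphB rmorphD /= !rmorph_sum /= fE uE.
  apply/eqP; rewrite subr_eq0; apply/eqP; congr (_ + _); apply: eq_bigr => j _.
    by rewrite rmorphM /= SRpi_repr mulrC.
  by rewrite /= SRpi_repr.
have := trace_pihomog_SRideal n q rI.
rewrite linearB linearB /= pihomog_dE // => /eqP; rewrite subr_eq0 => /eqP ->.
rewrite linearD linearD /= !trace_pihomog_sum !big1 ?addr0 // => j _.
have low k : (k <= n)%N -> tr q (pihomog mdeg k (linform C j * repr (a j))) = 0.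
  case: k => [|k] kn; first by rewrite pihomog_linform linear0.
  by rewrite trE (trace_low dimD general K_infinite st gq kn (pihomogP _ _ _))
    mulr0.
exact: low.
Qed.

End Vanishing.

(** Congruence modulo the linear forms to a combination of face monomials from
    [S]. *)
Definition face_span (S : {set {set V}}) f : Prop := exists c : {set V} -> K,
  in_ideal predT theta (pi (f - \sum_(G in S) c G *: xmon K G)).

Lemma in_ideal_SRpi0 f : SRideal Delta f -> in_ideal predT theta (pi f).
Proof. by move/SRpi_eq0 ->; apply: in_ideal0. Qed.

Lemma face_span_lin S c f g : face_span S f -> face_span S g ->
  face_span S (c *: f + g).
Proof.
case=> a ha [b hb]; exists (fun G => c * a G + b G).
rewrite (_ : _ - _ = c *: (f - \sum_(G in S) a G *: xmon K G) +
    (g - \sum_(G in S) b G *: xmon K G)).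
  by rewrite rmorphD /= pi_scale; apply: in_ideal_lin.
rewrite scalerBr scaler_sumr addrACA -opprD -big_split; congr (_ - _).
by apply: eq_bigr => G _; rewrite scalerDl scalerA.
Qed.

Lemma homog_face_span (S : {set {set V}}) e f :
    (forall G, G \in Delta -> #|G| = e -> G \in S) ->
  f \is e.-homog -> face_span S f.
Proof.
move=> eS; have N0 : face_span S 0.
  exists (fun=> 0); rewrite big1 ?subr0 ?rmorph0; first exact: in_ideal0.
  by move=> G _; rewrite scale0r.
have Nideal g : in_ideal predT theta (pi g) -> face_span S g.
  by move=> hg; exists (fun=> 0); rewrite big1 ?subr0 // => G _;
    rewrite scale0r.
apply: (squarefree_reduction dimD general) => //.
- by move=> c g h; apply: face_span_lin.
- by move=> m _ mD; apply/Nideal/in_ideal_SRpi0/SRideal_nonface.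
- by move=> i m _; apply: Nideal; rewrite rmorphM mulrC; apply: in_ideal_gen.
move=> G GD cG; exists (fun H => (H == G)%:R).
rewrite (bigD1 G) ?eS //= eqxx scale1r big1 ?addr0 => [|H /andP[_ /negPf ->]];
  last by rewrite scale0r.
by rewrite subrr rmorph0; apply: in_ideal0.
Qed.

Lemma lsop_general : lsop Delta C.
Proof.
exists #|Delta : {set {set V}}|, (fun k => xmon K (enum_val k)) => p.
have [c hc] : face_span Delta p.
  rewrite [p]mpolyE; elim/big_rec: _ => [|m g _ IH].
    by apply: (@homog_face_span _ 0) => //; apply: rpred0.
  apply: face_span_lin => //; apply: (@homog_face_span _ (mdeg m)) => //.
  by rewrite dhomogX eqxx.
exists (fun k => c (enum_val k)).
by rewrite (big_enum_val (fun G => c G *: xmon K G)) in hc.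
Qed.

Local Notation R := #|kfaces Delta n|.

Definition facet_mx : 'M[K]_(R, #|kfaces Delta n.+1|) :=
  \matrix_(g, k) scaled_inc C (enum_val g) (enum_val k).

Definition conormal_row (y : 'M[K]_(n.+1, R)) : 'rV[K]_R :=
  \row_g \sum_i y i g * conormal C (enum_val g) i.

Lemma conormal_row_is_linear : linear conormal_row.
Proof.
move=> c x y; apply/rowP => g; rewrite !mxE mulr_sumr -big_split.
by apply: eq_bigr => i _; rewrite !mxE mulrDl mulrA.
Qed.
HB.instance Definition _ :=
  GRing.isLinear.Build K _ _ _ conormal_row conormal_row_is_linear.

(** The rows of [y] are [n.+1] vectors indexed by the ridges; its columns are
    the vectors attached to the single ridges. *)
Definition cocycles : {vspace 'M[K]_(n.+1, R)} :=
  lker (linfun (mulmxr facet_mx : 'M_(n.+1, R) -> 'M_(n.+1, _))).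

Definition sigma_space : {vspace 'rV[K]_R} :=
  (linfun conormal_row @: cocycles)%VS.

Lemma sum_facet_ridges F (h : {set V} -> K) : F \in kfaces Delta n.+1 ->
  \sum_(G in kfaces Delta n) scaled_inc C G F * h G =
  \sum_(u in F) scaled_inc C (F :\ u) F * h (F :\ u).
Proof.
rewrite inE => /andP[FD /eqP cF].
rewrite /scaled_inc; under eq_bigr => G _ do rewrite -mulrA.
rewrite (@sum_coboundary _ _ _ _ _ (fun G => fdet C F * h G)) //; last first.
  by move=> u _; apply: face_sub FD; apply: subD1set.
by apply: eq_bigr => u _; rewrite mulrA.
Qed.

Lemma cocyclesP (y : 'M[K]_(n.+1, R)) :
  reflect (forall F i, F \in kfaces Delta n.+1 ->
     \sum_(u in F) scaled_inc C (F :\ u) F * extend (y i) (F :\ u) = 0)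
    (y \in cocycles).
Proof.
have mulE i k : (y *m facet_mx) i k =
    \sum_(u in enum_val k) scaled_inc C (enum_val k :\ u) (enum_val k) *
      extend (y i) (enum_val k :\ u).
  rewrite -(sum_facet_ridges (extend (y i))) ?enum_valP //.
  rewrite (sum_extend (y i) (fun c G => scaled_inc C G (enum_val k) * c)) mxE.
  by apply: eq_bigr => g _; rewrite mxE mulrC.
rewrite memv_ker lfunE /=; apply: (iffP eqP) => [/matrixP y0 F i Fk|y0].
  by rewrite -(enum_rankK_in Fk Fk) -mulE y0 mxE.
by apply/matrixP => i k; rewrite mulE mxE y0 ?enum_valP.
Qed.

Definition ridge_comb (x : 'rV[K]_R) : A := \sum_g x 0 g *: xmon K (enum_val g).

Lemma ridge_comb_homog x : ridge_comb x \is n.-homog.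
Proof.
apply: rpred_sum => g _; apply: rpredZ.
have /[!inE]/andP[_ /eqP cG] := enum_valP g.
by have := xmon_homog K (enum_val g); rewrite cG.
Qed.

(** One inclusion is [sigma_of_cocycle]. For the other one, a functional [t]
    that vanishes on [sigma_space] kills, after multiplication by each
    coordinate of the conormals, the row kernel of [facet_mx]; these products
    are thus in its column space, which provides the covectors needed to form
    a trace. *)
Theorem sigma_spaceP x : in_sigma theta (pi (ridge_comb x)) <->
  x \in sigma_space.
Proof.
split; last first.
  case/memv_imgP => y yY ->; rewrite lfunE /=.
  have /cocyclesP ycyc := yY.
  have := @sigma_of_cocycle _ _ _ _ C (fun G i => extend (y i) G) ycyc.
  rewrite (big_enum_val (fun G => _ *: xmon K G)) /=; congr (in_sigma _ (pi _)).
  apply: eq_bigr => g _; congr (_ *: _); rewrite mxE.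
  by apply: eq_bigr => i _; rewrite extend_val mulrC.
move=> xS; apply: separating_functional => t tP.
have /fin_all_exists[s sE] : forall i : 'I_n.+1, exists s : 'cV_ _,
    \col_g (t g 0 * conormal C (enum_val g) i) = facet_mx *m s.
  move=> i; apply: kermx_annihilator; apply/row_matrixP => k;
    rewrite row0 row_mul.
  set z := row k _; pose y : 'M[K]_(n.+1, R) := delta_mx i 0 *m z.
  have : y \in cocycles.
    rewrite memv_ker lfunE /= /y -mulmxA /z -row_mul mulmx_ker.
    by rewrite row0 mulmx0.
  move/(memv_img (linfun conormal_row))/tP; rewrite lfunE /= => <-.
  have yE a g : y a g = (a == i)%:R * z 0 g by rewrite mxE big_ord1 mxE andbT.
  apply/rowP => o; rewrite !ord1 mxE [RHS]mxE; apply: eq_bigr => g _.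
  rewrite [X in _ = X * _]mxE (bigD1 i) //= big1 ?addr0 => [|j /negPf ji];
    last first.
    by rewrite yE ji !mul0r.
  by rewrite yE eqxx mul1r [X in _ * X = _]mxE mulrA mulrAC.
have st G i : G \in kfaces Delta n -> extend (t^~ 0) G * conormal C G i =
    \sum_(F in kfaces Delta n.+1) scaled_inc C G F * extend ((s i)^~ 0) F.
  move=> Gr; rewrite (sum_extend ((s i)^~ 0) (fun c F => scaled_inc C G F * c)).
  have /matrixP/(_ (enum_rank_in Gr G) 0) := sE i;
    rewrite !mxE enum_rankK_in //.
  have -> : extend (t^~ 0) G = t (enum_rank_in Gr G) 0.
    by rewrite -(extend_val (t^~ 0)) enum_rankK_in.
  move=> ->.
  by apply: eq_bigr => k _; rewrite mxE enum_rankK_in.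
have [q gq] := generic_exists dimD general K_infinite.
have := trace_sigma st gq (ridge_comb_homog x) xS.
rewrite linear_sum /= => E; apply/matrixP => a b; rewrite !ord1 !mxE -[RHS]E.
apply: eq_bigr => g _;
  rewrite linearZ /= (trace_ridge general st) ?enum_valP //.
by rewrite extend_val.
Qed.

Lemma ridge_comb_is_linear : linear ridge_comb.
Proof.
move=> c x y; rewrite /ridge_comb scaler_sumr -big_split.
by apply: eq_bigr => g _; rewrite !mxE scalerDl scalerA.
Qed.
HB.instance Definition _ :=
  GRing.isLinear.Build K _ _ _ ridge_comb ridge_comb_is_linear.

(** A basis of a complement of [sigma_space] gives a basis of the quotient,
    every homogeneous polynomial being congruent to a combination of ridge
    monomials. *)
Lemma sigma_quot_dim_general : sigma_quot_dim Delta C n (\dim sigma_space^C).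
Proof.
pose B := vbasis sigma_space^C.
exists (fun k => ridge_comb B`_k) => [k|p pn]; first exact: ridge_comb_homog.
have [c0 hc0] : face_span (kfaces Delta n) p.
  by apply: homog_face_span pn => G GD cG; rewrite inE GD cG eqxx.
pose x : 'rV[K]_R := \row_g c0 (enum_val g).
have {hc0} px : in_ideal predT theta (pi (p - ridge_comb x)).
  rewrite (big_enum_val (fun G => c0 G *: xmon K G)) in hc0.
  move: hc0; congr (in_ideal _ _ (pi (_ - _))).
  by apply: eq_bigr => g _; rewrite mxE.
have key (c : 'rV_(\dim sigma_space^C)) :
    in_sigma theta (pi (p - \sum_k c 0 k *: ridge_comb B`_k)) <->
    x - \sum_k c 0 k *: B`_k \in sigma_space.
  have E : ridge_comb (\sum_k c 0 k *: B`_k) = \sum_k c 0 k *: ridge_comb B`_k.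
    by rewrite (linear_sum ridge_comb); apply: eq_bigr => k _; rewrite linearZ.
  rewrite -sigma_spaceP (linearB ridge_comb) /= E.
  set z := \sum_k _; split=> h.
    rewrite (_ : _ - z = (p - z) - (p - ridge_comb x)); last first.
      by rewrite opprB [RHS]addrC addrA subrK.
    by rewrite rmorphB; apply: in_sigmaB => //; apply: in_ideal_sigma.
  rewrite (_ : p - z = (p - ridge_comb x) + (ridge_comb x - z));
    last by rewrite addrA subrK.
  by rewrite rmorphD; apply: in_sigmaD => //; apply: in_ideal_sigma.
have xC := memv_projC sigma_space x.
exists (\row_k coord B k (x - projv sigma_space x)); split.
  apply/key; under eq_bigr => k _ do rewrite mxE.
  by rewrite -coord_vbasis // subKr memv_proj.
move=> c /key hc; apply/rowP => k; rewrite mxE.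
have /coord_sum_free <- : free B by apply: basis_free (vbasisP _).
congr (coord _ _ _); apply/eqP;
  rewrite -subr_eq0 -memv0 -(capv_compl sigma_space).
rewrite memv_cap; apply/andP; split.
  rewrite (_ : _ - _ = (x - \sum_k c 0 k *: B`_k) - projv sigma_space x);
    last by rewrite addrAC.
  by apply: memvB => //; apply: memv_proj.
apply: memvB => //; apply: memv_suml => j _; apply: memvZ; apply: vbasis_mem.
by apply: mem_nth; rewrite size_tuple.
Qed.

End SigmaQuotient.

(** * Cocycles with values in K^d *)

Section LinkIncidence.
Variables (K : fieldType) (V : finType) (Delta : complex V).
Implicit Types (F G : {set V}) (u v w : V).

Lemma kfaces_link v k G :
  (G \in kfaces (link Delta [set v]) k) =
    (v \notin G) && (v |: G \in kfaces Delta k.+1).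
Proof.
rewrite !inE setI_eq0 disjoints1 cardsU1.
case: (boolP (v \in G)) => vG; rewrite ?andbF //= add1n eqSS andbT.
case: (boolP (v |: G \in Delta)) => vGD; rewrite ?andbF //= andbT.
by rewrite (face_sub (subsetUr [set v] G)).
Qed.

Definition link_sign v G : K :=
  (-1) ^+ #|[set x in G | (enum_rank v < enum_rank x)%N]|.

Lemma link_sign_sqr v G : link_sign v G * link_sign v G = 1.
Proof. by rewrite /link_sign -expr2 sqrr_sign. Qed.

(** Passing to the link of [v] changes the incidence of two faces by a product
    of one sign for each of them, so that cocycles correspond after rescaling
    by [link_sign]. *)
Lemma incidence_link F u v : u \in F -> v \in F -> u != v ->
  incidence K (F :\ u) F = link_sign v (F :\ v) * link_sign v (F :\ v :\ u)
    * incidence K (F :\ v :\ u) (F :\ v).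
Proof.
move=> uF vF uv; rewrite !incidence_setD1 ?inE ?uv //.
have -> : #|[set w in F :\ u | (enum_rank w < enum_rank u)%N]| =
    ((enum_rank v < enum_rank u) +
      #|[set w in F :\ v :\ u | (enum_rank w < enum_rank u)%N]|)%N.
  rewrite (cardsD1 v) !inE vF eq_sym uv /=; congr (_ + _)%N;
    apply: eq_card => w.
  by rewrite !inE; case: (w == v); case: (w == u); case: (w \in F).
have -> : link_sign v (F :\ v) = (-1) ^+ (enum_rank v < enum_rank u)%N *
  link_sign v (F :\ v :\ u).
  rewrite /link_sign -exprD (cardsD1 u) !inE uF uv /=; congr (_ ^+ (_ + _)%N);
    apply: eq_card => w.
  by rewrite !inE; case: (w == v); case: (w == u); case: (w \in F).
by rewrite exprD -[X in _ = X * _]mulrA link_sign_sqr mulr1.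
Qed.

End LinkIncidence.

Section Dimensions.
Variables (K : fieldType) (V : finType) (Delta : complex V).
Implicit Types (F G : {set V}) (u v w : V).

Section AnyDimension.
Variables (n : nat) (C : 'M[K]_(n.+1, #|V|)).
Hypothesis general : forall F : {set V}, #|F| = n.+1 -> fdet C F != 0.
Local Notation R := #|kfaces Delta n|.

(** The two matrices differ by the invertible diagonal matrix of the
    determinants of the facets. *)
Lemma facet_mx_rank : \rank (kermx (facet_mx Delta C)) =
  \rank (kermx (coboundary K Delta n)).
Proof.
pose d := \row_(k < #|kfaces Delta n.+1|) fdet C (enum_val k).
have -> : facet_mx Delta C = coboundary K Delta n *m diag_mx d.
  by apply/matrixP => g k; rewrite mul_mx_diag !mxE.
rewrite !mxrank_ker mxrankMfree // row_free_unit unitmxE det_diag unitfE.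
apply/prodf_neq0 => k _; rewrite mxE general //.
by have /[!inE]/andP[_ /eqP] := enum_valP k.
Qed.

Lemma dim_cocycles :
  \dim (cocycles Delta C) = (n.+1 * \rank (kermx (coboundary K Delta n)))%N.
Proof.
pose iota (i : 'I_n.+1) :=
  linfun (mulmx (delta_mx i (0 : 'I_1)) : 'rV[K]_R -> 'M_(n.+1, R)).
pose pr (i : 'I_n.+1) := linfun (row i : 'M[K]_(n.+1, R) -> 'rV_R).
have iotaE i x : iota i x = delta_mx i 0 *m x by rewrite lfunE.
have prE i x : pr i x = row i x by rewrite lfunE.
rewrite (@dim_retract_sum _ _ _ _ iota pr
  (fun=> lker (linfun (mulmxr (facet_mx Delta C) : 'rV_R -> _)))).
- by rewrite sum_nat_const card_ord dim_lker_mulmxr facet_mx_rank.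
- by move=> i x; rewrite prE iotaE row_mul rowE mul_delta_mx -rowE row_id.
- move=> i j x /negPf ij; rewrite prE iotaE row_mul rowE mul_delta_mx_cond.
  by rewrite eq_sym ij mulr0n mul0mx.
- by move=> i x; rewrite !memv_ker iotaE !lfunE /= -mulmxA => /eqP ->;
    rewrite mulmx0.
- move=> i w; rewrite !memv_ker prE !lfunE /= -row_mul => /eqP ->.
  by rewrite row0.
move=> w _; apply/matrixP => a g;
  rewrite summxE (bigD1 a) //= big1 ?addr0 => [|j /negPf ja].
  by rewrite iotaE prE !mxE big_ord1 !mxE !eqxx mul1r.
by rewrite iotaE prE !mxE big_ord1 !mxE eq_sym ja mul0r.
Qed.

(** The cocycles whose value at each ridge lies in the hyperplane spanned by
    the columns of that ridge. *)
Definition tangent_cocycles : {vspace 'M[K]_(n.+1, R)} :=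
  (cocycles Delta C :&: lker (linfun (@conormal_row K V Delta n C)))%VS.

Lemma dim_sigma_compl :
  (\dim (sigma_space Delta C)^C + n.+1 * \rank (kermx (coboundary K Delta n)) =
   R + \dim tangent_cocycles)%N.
Proof.
have := limg_ker_dim (linfun (@conormal_row K V Delta n C)) (cocycles Delta C).
rewrite dim_cocycles -/(sigma_space Delta C) -/tangent_cocycles => E.
have := dimvS (subvf (sigma_space Delta C)).
rewrite dimv_compl dimvf dim_matrix mul1r => le.
by rewrite -E addnCA subnK // addnC.
Qed.

End AnyDimension.

(** In dimension zero the only ridge is the empty face, with conormal 1. *)
Lemma dim_tangent0 (C : 'M[K]_(1, #|V|)) : \dim (tangent_cocycles C) = 0%N.
Proof.
apply/eqP; rewrite dimv_eq0 -subv0; apply/subvP => y;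
  rewrite memv_cap memv0 => /andP[_].
rewrite memv_ker lfunE /= => /eqP/rowP y0; apply/eqP/matrixP => i g;
  rewrite ord1.
have := y0 g; rewrite !mxE big_ord1 /conormal expr0 mul1r.
by rewrite det_mx00 mulr1.
Qed.

Section Positive.
Variables (n : nat) (C : 'M[K]_(n.+2, #|V|)).
Hypotheses (dimD : dimS Delta = n.+2)
           (general : forall F : {set V}, #|F| = n.+2 -> fdet C F != 0).
Local Notation R := #|kfaces Delta n.+1|.
Local Notation pt := (pt C).
Implicit Type y : 'M[K]_(n.+2, R).

Definition ridge_vec y G (i : 'I_n.+2) : K := extend (y i) G.

Section Coordinates.
Variable a : {set V} * V -> 'I_n.+2 -> K.
Hypothesis aP : forall G v, G \in Delta -> v \in G ->
  forall u, u \in G -> dotv (a (G, v)) (pt u) = (u == v)%:R.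

(** The coefficient along the column of [v] of the vector that [y] attaches to
    [G], read off by the dual covector [a (G, v)]. *)
Definition tangent_coord y G v : K := dotv (a (G, v)) (ridge_vec y G).

Lemma tangent_ridge y G i : y \in tangent_cocycles C ->
  G \in kfaces Delta n.+1 ->
  ridge_vec y G i = \sum_(v in G) tangent_coord y G v * pt v i.
Proof.
rewrite memv_cap => /andP[_]; rewrite memv_ker lfunE /= => /eqP/rowP y0 Gr.
have [GD /eqP cG] : G \in Delta /\ #|G| == n.+1 by apply/andP;
  rewrite inE in Gr.
have [X GX cX] : exists2 X : {set V}, G \subset X & #|X| = n.+2.
  by apply: extend_card; rewrite cG leqnSn (card_vertices dimD).
have [w wX GE] := subset_setD1 GX (etrans cX (congr1 S (esym cG))).
have span j : ridge_vec y G j = \sum_(v in G) coord_of C X v (ridge_vec y G) *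
  pt v j.
  rewrite (coord_of_span general _ j cX) (big_setD1 w) //= -GE.
  rewrite {1}/coord_of -GE; have -> : dotv (conormal C G) (ridge_vec y G) = 0.
    have := y0 (enum_rank_in Gr G); rewrite !mxE => E; rewrite -[RHS]E.
    apply: eq_bigr => k _; rewrite enum_rankK_in // mulrC; congr (_ * _).
    by rewrite /ridge_vec -{1}(enum_rankK_in Gr Gr) extend_val.
  by rewrite !mul0r add0r.
rewrite span; apply: eq_bigr => v vG; congr (_ * _); rewrite /tangent_coord.
rewrite /dotv; under eq_bigr => j _ do rewrite span mulr_sumr.
rewrite exchange_big (bigD1 v) //= [X in _ + X]big1 ?addr0 => [|u /andP[uG uv]].
  under eq_bigr => j _ do rewrite mulrCA.
  by rewrite -mulr_sumr -/(dotv _ _) aP // eqxx mulr1.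
under eq_bigr => j _ do rewrite mulrCA.
by rewrite -mulr_sumr -/(dotv _ _) aP // (negPf uv) mulr0.
Qed.

(** Pair the cocycle condition at [F] with the covector dual to [v] in [F]: it
    selects the coefficients along the column of [v]. *)
Lemma tangent_local_cocycle y F v : y \in tangent_cocycles C ->
    F \in kfaces Delta n.+2 -> v \in F ->
  \sum_(u in F :\ v) incidence K (F :\ u) F * tangent_coord y (F :\ u) v = 0.
Proof.
move=> yX Fk vF.
have [FD /eqP cF] : F \in Delta /\ #|F| == n.+2 by apply/andP;
  rewrite inE in Fk.
have ridge u : u \in F -> F :\ u \in kfaces Delta n.+1.
  by move=> uF; apply: kfaces_setD1.
have coordE u : u \in F ->
    dotv (a (F, v)) (ridge_vec y (F :\ u)) =
      if u == v then 0 else tangent_coord y (F :\ u) v.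
  move=> uF; rewrite /dotv;
    under eq_bigr => j _ do rewrite (tangent_ridge _ yX (ridge u uF)) mulr_sumr.
  rewrite exchange_big /=.
  have E w : w \in F :\ u ->
    \sum_j a (F, v) j * (tangent_coord y (F :\ u) w * pt w j) =
      tangent_coord y (F :\ u) w * (w == v)%:R.
    rewrite inE => /andP[_ wF]; under eq_bigr => j _ do rewrite mulrCA.
    by rewrite -mulr_sumr -/(dotv _ _) aP.
  rewrite (eq_bigr _ E); have [->|uv] := eqVneq u v.
    by rewrite big1 // => w; rewrite !inE => /andP[/negPf -> _]; rewrite mulr0.
  rewrite (bigD1 v) /= ?inE ?vF 1?eq_sym ?uv // eqxx mulr1 big1 ?addr0 // =>
    w /andP[_ /negPf ->].
  by rewrite mulr0.
have [/cocyclesP ycyc _] := memv_capP yX.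
apply: (mulfI (general cF)); rewrite mulr0 mulr_sumr.
transitivity (dotv (a (F, v)) (fun i => \sum_(u in F) scaled_inc C (F :\ u) F *
  ridge_vec y (F :\ u) i)).
  rewrite /dotv; under [RHS]eq_bigr => j _ do rewrite mulr_sumr.
  rewrite exchange_big /=.
  have E u : u \in F ->
      \sum_j a (F, v) j * (scaled_inc C (F :\ u) F * ridge_vec y (F :\ u) j) =
      scaled_inc C (F :\ u) F *
        (if u == v then 0 else tangent_coord y (F :\ u) v).
    move=> uF; under eq_bigr => j _ do rewrite mulrCA.
    by rewrite -mulr_sumr -/(dotv _ _) coordE.
  rewrite (eq_bigr _ E) (big_setD1 v vF) /= eqxx mulr0 add0r.
  apply: eq_bigr => u; rewrite !inE => /andP[/negPf -> _].
  by rewrite /scaled_inc mulrA [fdet _ _ * _]mulrC.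
by rewrite /dotv big1 // => j _; rewrite ycyc ?mulr0.
Qed.

End Coordinates.

Local Notation L v := (link Delta [set v]).

Lemma link_sub v F u : F \in L v -> F :\ u \in L v.
Proof.
rewrite !inE !setI_eq0 !disjoints1 inE negb_and => /andP[FD /andP[vFD vF]].
rewrite (face_sub (subD1set F u) FD) vF orbT andbT /=.
by apply: face_sub vFD; apply/setUS/subD1set.
Qed.

(** The inverse construction: a cochain on the link of [v] spreads to the
    ridges containing [v], with values along the column of [v]. *)
Definition vertex_cone v (c : 'rV[K]_#|kfaces (L v) n|) : 'M[K]_(n.+2, R) :=
  \matrix_(i < n.+2, g < R) if v \in enum_val g then
    link_sign K v (enum_val g :\ v) * extend (c 0) (enum_val g :\ v) *
      pt v i else 0.

Lemma vertex_cone_is_linear v : linear (@vertex_cone v).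
Proof.
move=> b x y; apply/matrixP => i g; rewrite !mxE; case: ifP => _.
  by rewrite extend_lin; ring.
by rewrite mulr0 addr0.
Qed.
HB.instance Definition _ v :=
  GRing.isLinear.Build K _ _ _ (@vertex_cone v) (@vertex_cone_is_linear v).

Lemma ridge_vec_cone v c G i : G \in kfaces Delta n.+1 ->
  ridge_vec (@vertex_cone v c) G i =
    (if v \in G then link_sign K v (G :\ v) * extend (c 0) (G :\ v) else 0) *
      pt v i.
Proof.
move=> Gr; have -> : ridge_vec (vertex_cone c) G i =
  vertex_cone c i (enum_rank_in Gr G).
  by rewrite /ridge_vec -(extend_val (vertex_cone c i)) enum_rankK_in.
by rewrite mxE enum_rankK_in //; case: ifP => //; rewrite mul0r.
Qed.

Lemma vertex_cone_tangent v c :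
    c \in face_cocycles K (L v) n ->
  vertex_cone c \in tangent_cocycles C.
Proof.
move=> /(face_cocyclesP _ (@link_sub v)) ccyc; rewrite memv_cap; apply/andP;
  split; last first.
  rewrite memv_ker lfunE /=; apply/eqP/rowP => g; rewrite !mxE.
  have [vg|vg] := boolP (v \in enum_val g); last first.
    by rewrite big1 // => i _; rewrite mxE (negPf vg) mul0r.
  under eq_bigr => i _ do rewrite mxE vg -mulrA [pt v i * _]mulrC.
  rewrite -mulr_sumr -/(dotv _ _) conormal_vertex ?mulr0 //.
  by have /[!inE]/andP[_ /eqP] := enum_valP g.
apply/cocyclesP => F i Fk.
have [FD /eqP cF] : F \in Delta /\ #|F| == n.+2 by apply/andP;
  rewrite inE in Fk.
have ridge u : u \in F -> F :\ u \in kfaces Delta n.+1.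
  by move=> uF; apply: kfaces_setD1.
under eq_bigr => u uF do rewrite -/(ridge_vec (vertex_cone c) (F :\ u) i)
  ridge_vec_cone ?ridge // !inE.
have [vF|vF] := boolP (v \in F); last first.
  by rewrite big1 // => u _; rewrite andbF mul0r mulr0.
rewrite (big_setD1 v vF) /= eqxx /= mul0r mulr0 add0r.
have FvL : F :\ v \in kfaces (L v) n.+1 by rewrite kfaces_link setD11 setD1K.
transitivity (fdet C F * link_sign K v (F :\ v) * pt v i *
    \sum_(u in F :\ v)
      incidence K (F :\ v :\ u) (F :\ v) * extend (c 0) (F :\ v :\ u)).
  rewrite mulr_sumr; apply: eq_bigr => u; rewrite !inE => /andP[uv uF].
  rewrite eq_sym uv /= /scaled_inc (incidence_link K uF vF uv).
  have -> : F :\ u :\ v = F :\ v :\ u by rewrite !setDDl setUC.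
  transitivity ((link_sign K v (F :\ v :\ u) * link_sign K v (F :\ v :\ u)) *
    (fdet C F * link_sign K v (F :\ v) * pt v i *
      (incidence K (F :\ v :\ u) (F :\ v) * extend (c 0) (F :\ v :\ u))));
        first ring.
  by rewrite link_sign_sqr mul1r.
by rewrite ccyc ?mulr0.
Qed.

(** Coefficients along the columns of the vertices split the tangent cocycles
    into cocycles of the links. Vertices in [V] that are not in the complex
    have an empty link and contribute zero. *)
Lemma dim_tangent : \dim (tangent_cocycles C) =
  (\sum_v \rank (kermx (coboundary K (L v) n)))%N.
Proof.
have /fin_all_exists[a aP'] : forall p : {set V} * V, exists b : 'I_n.+2 -> K,
    p.1 \in Delta -> p.2 \in p.1 -> forall u, u \in p.1 ->
      dotv b (pt u) = (u == p.2)%:R.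
  case=> G v /=; have [GD|GD] := boolP (G \in Delta); last by exists (fun=> 0).
  have [vG|vG] := boolP (v \in G); last by exists (fun=> 0).
  by have [b bP] := face_covector dimD general GD vG; exists b.
have aP G v : G \in Delta -> v \in G -> forall u, u \in G ->
  dotv (a (G, v)) (pt u) = (u == v)%:R.
  exact: (aP' (G, v)).
pose pr0 v y : 'rV[K]_#|kfaces (L v) n| :=
  \row_h (link_sign K v (enum_val h) * tangent_coord a y (v |: enum_val h) v).
have pr0_lin v : linear (pr0 v).
  move=> b x y; apply/rowP => h; rewrite !mxE.
  have -> : tangent_coord a (b *: x + y) (v |: enum_val h) v =
      b * tangent_coord a x (v |: enum_val h) v +
        tangent_coord a y (v |: enum_val h) v.
    rewrite /tangent_coord /dotv mulr_sumr -big_split; apply: eq_bigr => i _ /=.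
    rewrite /ridge_vec /extend !mulr_sumr -big_split; apply: eq_bigr => g _ /=.
    by rewrite !mxE; ring.
  ring.
pose prM v := GRing.isLinear.Build K _ _ _ (pr0 v) (pr0_lin v).
pose prL v : {linear 'M[K]_(n.+2, R) -> 'rV[K]_#|kfaces (L v) n|} :=
  HB.pack (pr0 v) (prM v).
have linkP v (h : 'I_#|kfaces (L v) n|) :
    v \notin enum_val h /\ v |: enum_val h \in kfaces Delta n.+1.
  by have := enum_valP h; rewrite kfaces_link => /andP.
have inD G k : G \in kfaces Delta k -> G \in Delta by rewrite inE => /andP[].
have coord_cone v w c G : G \in kfaces Delta n.+1 -> w \in G ->
    tangent_coord a (@vertex_cone v c) G w =
    if v == w then link_sign K v (G :\ v) * extend (c 0) (G :\ v) else 0.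
  move=> Gr wG; rewrite /tangent_coord.
  have -> : ridge_vec (vertex_cone c) G = fun i =>
      (if v \in G then link_sign K v (G :\ v) * extend (c 0) (G :\ v) else 0) *
        pt v i.
    by apply: functional_extensionality_dep => i; rewrite ridge_vec_cone.
  rewrite dotvZ; case: ifP => vG; first rewrite aP ?(inD _ _ Gr) //.
    by case: eqP; rewrite ?mulr1 ?mulr0.
  by rewrite mul0r; case: eqP => // vw; rewrite vw wG in vG.
rewrite (@dim_retract_sum _ _ _ _ (fun v => linfun (@vertex_cone v))
  (fun v => linfun (prL v))
  (fun v => face_cocycles K (L v) n)).
- by apply: eq_bigr => v _; rewrite dim_lker_mulmxr.
- move=> v c; rewrite !lfunE /=; apply/rowP => h; rewrite mxE.
  have [vh vhr] := linkP v h; rewrite coord_cone ?setU11 // eqxx setU1K //.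
  by rewrite mulrA link_sign_sqr mul1r extend_val.
- move=> v w c vw; rewrite !lfunE /=; apply/rowP => h; rewrite !mxE.
  have [wh whr] := linkP w h.
  by rewrite coord_cone ?setU11 // (negPf vw) mulr0.
- by move=> v c cK; rewrite lfunE; apply: vertex_cone_tangent.
- move=> v y yX; rewrite lfunE /=;
    apply/(face_cocyclesP _ (@link_sub v)) => H HL.
  have := HL; rewrite kfaces_link => /andP[vH vHk].
  have FE : (v |: H) :\ v = H by rewrite setU1K.
  have := tangent_local_cocycle aP yX vHk (setU11 v H).
  rewrite FE => loc; apply: (mulfI (_ : link_sign K v H != 0)).
    by rewrite signr_eq0.
  rewrite mulr0 -[RHS]loc mulr_sumr; apply: eq_bigr => u uH.
  have uv : u != v by apply: contraNneq vH => <-.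
  rewrite (incidence_link K _ (setU11 v H) uv) ?FE ?inE ?uH ?orbT //.
  have HuL : H :\ u \in kfaces (L v) n.
    rewrite inE link_sub; last by move: HL; rewrite inE => /andP[].
    by have /[!inE]/andP[_ /eqP cH] := HL; rewrite (card_setD1 uH cH) /=.
  have -> : extend (pr0 v y 0) (H :\ u) =
      link_sign K v (H :\ u) * tangent_coord a y (v |: H :\ u) v.
    by rewrite -(enum_rankK_in HuL HuL) extend_val mxE.
  have -> : (v |: H) :\ u = v |: H :\ u.
    by apply/setP => x; rewrite !inE; case: (eqVneq x v) => [->|] //=;
      rewrite eq_sym uv.
  ring.
move=> y yX; apply/matrixP => i g; rewrite summxE.
have gr := enum_valP g.
transitivity (ridge_vec y (enum_val g) i);
  first by rewrite /ridge_vec extend_val.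
rewrite (tangent_ridge aP i yX gr) big_mkcond; apply: eq_bigr => v _.
rewrite !lfunE /= mxE; case: ifP => // vg; congr (_ * _).
have hL : enum_val g :\ v \in kfaces (L v) n
  by rewrite kfaces_link setD11 setD1K.
rewrite -{2}(enum_rankK_in hL hL) extend_val mxE enum_rankK_in // setD1K //.
by rewrite mulrA link_sign_sqr mul1r.
Qed.

End Positive.
End Dimensions.

(** * Truncated Euler characteristics and face numbers *)

Section EulerCharacteristic.
Variables (K : fieldType) (V : finType).
Implicit Types (F G H : {set V}) (u v w : V) (D : {set {set V}}).

(** Exactly one of the two removals passes over the other vertex. *)
Lemma incidence_swap F u w : u \in F -> w \in F -> u != w ->
  incidence K (F :\ u) F * incidence K (F :\ u :\ w) (F :\ u) =
  - (incidence K (F :\ w) F * incidence K (F :\ w :\ u) (F :\ w)).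
Proof.
move=> uF wF uw; have wu : w != u by rewrite eq_sym.
rewrite !incidence_setD1 ?inE ?uw ?wu //.
have split x y : x \in F -> y \in F -> x != y ->
    #|[set z in F :\ x | (enum_rank z < enum_rank x)%N]| =
    ((enum_rank y < enum_rank x) +
      #|[set z in F :\ y :\ x | (enum_rank z < enum_rank x)%N]|)%N.
  move=> xF yF xy; rewrite (cardsD1 y) !inE yF eq_sym xy /=; congr (_ + _)%N.
  by apply: eq_card => z; rewrite !inE; case: (z == x); case: (z == y);
    case: (z \in F).
rewrite (split u w) // (split w u) // !exprD.
have : (enum_rank w < enum_rank u)%N = ~~ (enum_rank u < enum_rank w)%N.
  rewrite -leqNgt [RHS]leq_eqVlt; case: eqP => [/ord_inj/enum_rank_inj E|//].
  by rewrite E eqxx in uw.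
by move=> ->; case: (enum_rank u < enum_rank w)%N; rewrite /= expr0 expr1; ring.
Qed.

(** Between [H] and [F] there are either no intermediate faces or exactly two,
    with opposite signs. *)
Lemma coboundary_sqr0 D k : (forall F u, F \in D -> F :\ u \in D) ->
  coboundary K D k *m coboundary K D k.+1 = 0.
Proof.
move=> Dsub; apply/matrixP => i j; rewrite !mxE.
have /[!inE]/andP[FD /eqP cF] := enum_valP j.
have /[!inE]/andP[_ /eqP cH] := enum_valP i.
set F := enum_val j in FD cF *; set H := enum_val i in cH *.
transitivity (\sum_(G in kfaces D k.+1) incidence K G F * incidence K H G).
  rewrite (big_enum_val (fun G => incidence K G F * incidence K H G)).
  by apply: eq_bigr => g _; rewrite !mxE mulrC.
rewrite (sum_coboundary (incidence K H) cF (fun u _ => Dsub F u FD)).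
have inc0 u : u \in F -> (u \in H) || ~~ (H \subset F) ->
  incidence K H (F :\ u) = 0.
  move=> uF HF; rewrite /incidence big_pred0 // => w;
    apply/negP => /andP[_ /eqP E].
  move: HF; rewrite E !inE eqxx andbF /= => /negP; apply.
  by apply: subset_trans (subD1set _ _) (subD1set _ _).
have [HF|HF] := boolP (H \subset F); last first.
  by rewrite big1 // => u uF; rewrite inc0 ?HF ?orbT ?mulr0.
have /cards2P[u [w [uw FH]]] : #|F :\: H| == 2.
  by rewrite cardsD (setIidPr HF) cF cH -addn2 addKn.
have /setP FHx := FH.
have uFH : (u \in F) && (u \notin H) by have := FHx u; rewrite !inE eqxx andbC.
have wFH : (w \in F) && (w \notin H) by have := FHx w;
  rewrite !inE eqxx orbT andbC.
case/andP: uFH => uF uH; case/andP: wFH => wF wH.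
have HE x y : x \in F -> x \notin H -> y \in F -> y \notin H -> x != y ->
  H = F :\ x :\ y.
  move=> xF xH yF yH xy; apply/eqP; rewrite eqEcard !subsetD1 HF xH yH /=.
  have := cardsD1 x F; have := cardsD1 y (F :\ x).
  by rewrite !inE xF yF eq_sym xy /= cF => ->; rewrite !add1n cH => -[->].
rewrite (bigD1 u) //= (bigD1 w) /=; last by rewrite wF eq_sym.
rewrite big1 ?addr0 => [|x /andP[/andP[xF xu] xw]]; last first.
  rewrite inc0 ?mulr0 // HF orbF; apply/negPn/negP => xH.
  by have := FHx x; rewrite !inE xF xH (negPf xu) (negPf xw).
rewrite {1}(HE u w) // {1}(HE w u) 1?eq_sym // incidence_swap //.
by rewrite addNr.
Qed.

Definition cycle_rank D k : nat := \rank (kermx (coboundary K D k)).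

(** The subtraction in [bettiS] is not truncated because coboundaries are
    cocycles. *)
Lemma bettiS_succ D k : (forall F u, F \in D -> F :\ u \in D) ->
  (bettiS K D k.+1)%:Z = (cycle_rank D k.+1)%:Z - #|kfaces D k|%:Z +
    (cycle_rank D k)%:Z.
Proof.
move=> Dsub; rewrite /bettiS /cycle_rank.
have le : (\rank (coboundary K D k) <= \rank (kermx (coboundary K D k.+1)))%N.
  by apply/mxrankS/sub_kermxP/coboundary_sqr0.
have := rank_leq_row (coboundary K D k);
  rewrite (mxrank_ker (coboundary K D k)).
move: le; lia.
Qed.

(** The rank of a coboundary map contributes with opposite signs to two
    consecutive Betti numbers, except for the last one. *)
Lemma sum_bettiS D k : (forall F u, F \in D -> F :\ u \in D) ->
  \sum_(m < k.+1) (-1) ^+ m.+1 * (bettiS K D m)%:Z =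
  (-1) ^+ k.+1 * (cycle_rank D k)%:Z - \sum_(m < k) (-1) ^+ m *
    #|kfaces D m|%:Z.
Proof.
move=> Dsub; elim: k => [|k IH].
  by rewrite big_ord1 big_ord0 subr0 /bettiS subn0.
rewrite big_ord_recr /= IH big_ord_recr /= bettiS_succ // !exprS; ring.
Qed.

Lemma tchi_sum D (i : int) (k : nat) : i + 2%:Z = k%:Z ->
  tchi K D i = \sum_(m < k) (-1) ^+ m.+1 * (bettiS K D m)%:Z.
Proof. by rewrite /tchi => ->. Qed.

End EulerCharacteristic.

Section Arithmetic.
Variables (K : fieldType) (V : finType) (Delta : complex V) (n : nat).
Hypothesis dimD : dimS Delta = n.+1.
Notation f k := (#|kfaces Delta k|).
Notation L v := (link Delta [set v]).

Lemma complex_sub (F : {set V}) u : F \in Delta -> F :\ u \in Delta.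
Proof. by apply: face_sub; apply: subD1set. Qed.

(** Each face with [k.+1] elements is counted once per vertex. *)
Lemma sum_kfaces_link k : (\sum_v #|kfaces (L v) k| = k.+1 * f k.+1)%N.
Proof.
have -> : (\sum_v #|kfaces (L v) k| =
    \sum_(G : {set V}) \sum_(v | v \notin G) (v |: G \in kfaces Delta k.+1))%N.
  transitivity (\sum_v \sum_(G : {set V})
      ((v \notin G) && (v |: G \in kfaces Delta k.+1)))%N.
    apply: eq_bigr => v _; rewrite -sum1_card big_mkcond /=.
    by apply: eq_bigr => G _; rewrite kfaces_link; case: andP.
  rewrite exchange_big; apply: eq_bigr => G _; rewrite [RHS]big_mkcond.
  by apply: eq_bigr => v _; case: (v \notin G).
rewrite (@sum_pairs_setU1 nat V predT
  (fun G v => (v |: G \in kfaces Delta k.+1) : nat)).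
transitivity (\sum_(F in kfaces Delta k.+1) k.+1)%N;
  last by rewrite sum_nat_const mulnC.
rewrite [RHS]big_mkcond; apply: eq_bigr => F _.
transitivity (\sum_(v in F) (F \in kfaces Delta k.+1))%N.
  by apply: eq_big => [v|v /andP[vF _]]; rewrite ?andbT ?setD1K.
rewrite sum_nat_const; case: ifP => [|_]; last by rewrite muln0.
by rewrite inE => /andP[_ /eqP ->]; rewrite muln1.
Qed.

Lemma Posz_sum (I : finType) (g : I -> nat) :
  (\sum_i g i)%N%:Z = \sum_i (g i)%:Z.
Proof. exact: (big_morph Posz PoszD (erefl _)). Qed.

(** For [n = 0] the relevant cocycles of the links are in dimension -2. *)
Definition link_cycle_rank : nat :=
  if n is n'.+1 then (\sum_v cycle_rank K (L v) n')%N else 0%N.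

Lemma link_term :
  (-1) ^+ n *
    \sum_v (\sum_(m < n) (-1) ^+ m.+1 * (bettiS K (L v) m)%:Z) =
  link_cycle_rank%:Z + \sum_(j < n) (-1) ^+ (n + j) * (j * f j)%N%:Z.
Proof.
rewrite /link_cycle_rank; case: n => [|k].
  by rewrite big_ord0 addr0 big1 ?mulr0 // => v _; rewrite big_ord0.
have E v := @sum_bettiS K V (L v) k (@link_sub V Delta v).
rewrite (eq_bigr _ (fun v _ => E v)).
rewrite sumrB -mulr_sumr exchange_big /= big_ord_recl mul0n mulr0 add0r.
rewrite mulrBr mulrA -expr2 sqrr_sign mul1r Posz_sum; congr (_ + _).
rewrite mulr_sumr -sumrN; apply: eq_bigr => m _.
rewrite -mulr_sumr -Posz_sum sum_kfaces_link exprD.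
by rewrite -[nat_of_ord (lift _ _)]/(m.+1) !exprS; ring.
Qed.

Lemma sum_low_faces (T : {set V} -> int) :
    (forall F : {set V}, (1 < #|F|)%N -> T F = 0) ->
  \sum_(F in Delta) T F = T set0 + \sum_(v | [set v] \in Delta) T [set v].
Proof.
move=> T0; rewrite (bigD1 set0) ?face0 //=; congr (_ + _).
rewrite (bigID (fun F : {set V} => #|F| == 1%N)) /= [X in _ + X]big1 ?addr0;
  last first.
  move=> F /andP[/andP[_ F0] F1]; apply: T0; move: F0 F1; rewrite -card_gt0.
  by case: #|F| => [|[|]].
rewrite -(big_imset T (h := set1)) /=; last by move=> u v _ _ /set1_inj.
apply: eq_bigl => F; apply/andP/imsetP =>
  [[/andP[FD _] /cards1P[v Fv]]|[v vD ->]].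
  by exists v => //; rewrite unfold_in -Fv.
have {}vD : [set v] \in Delta := vD.
by rewrite vD cards1 eqxx -card_gt0 cards1.
Qed.

Lemma h_number_formula (h : nat) :
    (h + n.+1 * cycle_rank K Delta n = f n + link_cycle_rank)%N ->
  h%:Z = hnum Delta n.+1 n + (-1) ^+ n * \sum_(F in Delta)
    'C(n.+1 - #|F|, n)%:Z * tchi K (link Delta F) (n.+1%:Z - 2%:Z - #|F|%:Z).
Proof.
move=> hE.
have link0 : link Delta set0 = Delta.
  by apply/setP => G; rewrite inE set0U set0I eqxx andbT andbb.
have -> : \sum_(F in Delta) 'C(n.+1 - #|F|, n)%:Z *
      tchi K (link Delta F) (n.+1%:Z - 2%:Z - #|F|%:Z)
    = n.+1%:Z * (\sum_(m < n.+1) (-1) ^+ m.+1 * (bettiS K Delta m)%:Z)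
      + \sum_v \sum_(m < n) (-1) ^+ m.+1 * (bettiS K (L v) m)%:Z.
  pose T (F : {set V}) := if (#|F| <= 1)%N then
    'C(n.+1 - #|F|, n)%:Z *
      tchi K (link Delta F) (n.+1%:Z - 2%:Z - #|F|%:Z) else 0.
  rewrite (eq_bigr T) => [|F FD]; last first.
    rewrite /T; case: ifPn => //; rewrite -ltnNge => F1.
    have := face_card dimD FD; case: n => [|k] Fk; first by lia.
    by rewrite bin_small ?mul0r //; lia.
  rewrite sum_low_faces => [|F F1]; last by rewrite /T leqNgt F1.
  rewrite /T cards0 /= subn0 binSn link0 (@tchi_sum _ _ _ _ n.+1); last by lia.
  congr (_ + _); rewrite [LHS]big_mkcond; apply: eq_bigr => v _.
  rewrite cards1 /= subSS subn0 binn mul1r; case: ifPn => vD.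
    by apply: tchi_sum; lia.
  rewrite big1 // => m _; rewrite /bettiS.
  have empty : (#|kfaces (L v) m| = 0)%N.
    apply/eqP; rewrite cards_eq0; apply/eqP/setP => G; rewrite kfaces_link !inE.
    apply/negP => /andP[_ /andP[GD _]]; case/negP: vD; apply: face_sub GD.
    by rewrite sub1set setU11.
  have -> : \rank (kermx (coboundary K (L v) m)) = 0%N.
    by apply/eqP; rewrite -leqn0; apply: leq_trans (rank_leq_row _) _;
      rewrite empty.
  by rewrite sub0n mulr0.
rewrite mulrDr link_term sum_bettiS; last exact: complex_sub.
have hnumE : hnum Delta n.+1 n = (f n)%:Z +
    \sum_(j < n) (-1) ^+ (n + j) * ((n.+1 - j) * f j)%N%:Z.
  rewrite /hnum big_ord_recr /= subnn expr0 bin0 mul1n mul1r addrC;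
    congr (_ + _).
  apply: eq_bigr => j _; have jn := ltnW (ltn_ord j).
  rewrite subSn // binSn; congr (_ * _).
  have -> : (n + j = (n - j) + 2 * j)%N by rewrite mul2n -addnn addnA subnK.
  by rewrite exprD exprM sqrrN !expr1n mulr1.
have comb : \sum_(j < n) (-1) ^+ (n + j) * ((n.+1 - j) * f j)%N%:Z
    + \sum_(j < n) (-1) ^+ (n + j) * (j * f j)%N%:Z
    - (-1) ^+ n * (n.+1%:Z * \sum_(m < n) (-1) ^+ m * (f m)%:Z) = 0 :> int.
  apply/eqP; rewrite subr_eq0 -big_split !mulr_sumr;
    apply/eqP/eq_bigr => j _ /=.
  rewrite -mulrDr -PoszD -mulnDl subnK; last by rewrite ltnW // ltnS ltnW.
  by rewrite PoszM exprD; ring.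
have sq : (-1) ^+ n * (-1) ^+ n = 1 :> int by rewrite -expr2 sqrr_sign.
have hZ : h%:Z = (f n)%:Z + link_cycle_rank%:Z - n.+1%:Z *
  (cycle_rank K Delta n)%:Z by lia.
rewrite hZ hnumE; move: comb.
set a := \sum_(j < n) _; set b := \sum_(j < n) _;
  set c := \sum_(j < n) _ => comb.
have {}comb : a = (-1) ^+ n * (n.+1%:Z * c) - b
  by apply/eqP; rewrite -subr_eq0; apply/eqP; apply: etrans comb; ring.
rewrite comb exprS; transitivity ((f n)%:Z + link_cycle_rank%:Z
  - ((-1) ^+ n * (-1) ^+ n) * (n.+1%:Z * (cycle_rank K Delta n)%:Z));
      first by rewrite sq mul1r.
ring.
Qed.

End Arithmetic.

(** * General position is a nonempty open condition *)

Section GeneralPosition.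
Variables (K : fieldType) (V : finType) (n : nat).
Implicit Types (F : {set V}) (C : 'M[K]_(n.+1, #|V|)).

Definition general_position C : Prop :=
  \prod_(F : {set V} | #|F| == n.+1) fdet C F != 0.

Lemma general_positionP C :
  general_position C <-> forall F, #|F| = n.+1 -> fdet C F != 0.
Proof.
rewrite /general_position; split=> [/prodf_neq0 gC F /eqP|gC]; first exact: gC.
by apply/prodf_neq0 => F /eqP; apply: gC.
Qed.

Lemma general_position_open : zariski_open general_position.
Proof.
pose P : {mpoly K[n.+1 * #|V|]} := \prod_(F : {set V} | #|F| == n.+1)
  \det (\matrix_(i < n.+1, j < n.+1)
    nth 0 [seq 'X_(mxvec_index i (enum_rank v)) | v <- enum F] j).
exists (eq^~ P) => C.
have PE : P.@[mxvec C 0] = \prod_(F : {set V} | #|F| == n.+1) fdet C F.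
  rewrite rmorph_prod; apply: eq_bigr => F /eqP cF; rewrite /= -det_map_mx;
    congr (\det _).
  apply/matrixP => i j; rewrite !mxE.
  have [v0 _] : exists v, v \in F by apply/set0Pn; rewrite -card_gt0 cF.
  have sz : size (enum F) = n.+1 by rewrite -cardE.
  by rewrite !(nth_map v0) ?sz //= mevalXU mxvecE.
by rewrite /general_position -PE; split=> [CU|[_ ->]] //; exists P.
Qed.

Hypothesis K_infinite : forall s : seq K, exists x : K, x \notin s.

Lemma injective_family m : exists t : 'I_m -> K, injective t.
Proof.
have [s us sz] : exists2 s : seq K, uniq s & size s = m.
  elim: m => [|m [s us sz]]; first by exists [::].
  by have [x xs] := K_infinite s; exists (x :: s); rewrite /= ?xs ?sz.
exists (fun i => s`_i) => i j /eqP.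
by rewrite nth_uniq ?sz // => /eqP/ord_inj.
Qed.

(** The columns are points of the moment curve, whose minors are Vandermonde
    determinants. *)
Lemma general_position_exists : exists C, general_position C.
Proof.
have [t tinj] := injective_family #|V|.
exists (\matrix_(i, j) t j ^+ i); apply/general_positionP => F cF.
have sz : size (enum F) = n.+1 by rewrite -cardE.
have [v0 _] : exists v, v \in F by apply/set0Pn; rewrite -card_gt0 cF.
rewrite /fdet; have -> : colsub_of (\matrix_(i, j) t j ^+ i) n.+1 F =
    Vandermonde n.+1 (\row_j t (enum_rank (nth v0 (enum F) j))).
  by apply/matrixP => i j; rewrite !mxE (nth_map v0) ?sz // /pt mxE.
rewrite det_Vandermonde; apply/prodf_neq0 => i _; apply/prodf_neq0 => j ij.
rewrite !mxE subr_eq0 (inj_eq tinj) (inj_eq enum_rank_inj) nth_uniq ?enum_uniq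
  ?sz //.
by rewrite gtn_eqF.
Qed.

End GeneralPosition.

(** The matrix occurs on the left only, so all matrices in general position
    give the same dimension. *)
Lemma sigma_dimension (K : fieldType) (V : finType) (Delta : complex V) n
    (C : 'M[K]_(n.+1, #|V|)) :
    dimS Delta = n.+1 -> (forall F : {set V}, #|F| = n.+1 -> fdet C F != 0) ->
  (\dim (sigma_space Delta C)^C + n.+1 * cycle_rank K Delta n =
   #|kfaces Delta n| + link_cycle_rank K Delta n)%N.
Proof.
move=> dimD general; rewrite (dim_sigma_compl Delta general); congr (_ + _)%N.
by case: n C dimD general => [|n] C dimD general;
  [apply: dim_tangent0 | apply: dim_tangent].
Qed.

Theorem theorem3p10 (K : fieldType) (K_infinite : forall s : seq K, exists x : K, x \notin s)
    (V : finType) (Delta : complex V) (d : nat) (d_gt0 : (0 < d)%N)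
    (dim_Delta : dimS Delta = d) :
  exists2 h : nat, reduced_h K Delta d.-1 h &
    h%:Z = hnum Delta d d.-1
           + (-1) ^+ d.-1 * \sum_(F in Delta)
               'C(d - #|F|, d.-1)%:Z * tchi K (link Delta F) (d%:Z - 2%:Z - #|F|%:Z).
Proof.
case: d d_gt0 dim_Delta => // n _ dimD /=.
have [C0 C0U] := @general_position_exists K V n K_infinite.
have dimE (C : 'M[K]_(n.+1, #|V|)) : general_position C ->
    \dim (sigma_space Delta C)^C = \dim (sigma_space Delta C0)^C.
  move=> /general_positionP gC; apply/eqP.
  rewrite -(eqn_add2r (n.+1 * cycle_rank K Delta n)) (sigma_dimension dimD gC).
  by rewrite (sigma_dimension dimD) //; apply/general_positionP.
exists (\dim (sigma_space Delta C0)^C); last first.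
  by apply: (h_number_formula dimD); apply: (sigma_dimension dimD);
    apply/general_positionP.
rewrite /reduced_h dimD; exists (@general_position K V n); split.
- exact: general_position_open.
- by exists C0.
move=> C CU; rewrite -(dimE C CU); move/general_positionP: CU => gC; split.
  exact: lsop_general.
exact: sigma_quot_dim_general.
Qed.
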